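(* Let $0<p\le q\le r<1$ with $p+r<1$, let $\delta>0$, put $C_1=(L_1+L_2)^2/\mu$ and $C_2=1/(8C_1)$, and for $k\ge 0$ let $$\lambda_k=(k+1)^{-p},\quad \eta_k=C_1(k+1)^q,\quad \theta_k=C_2(k+1)^{-r},\quad N_k=\lceil (k+1)^{1+\delta}\rceil .$$ Let $\{x_k\}_{k\ge 0}$ be the sequence generated by the RVC-IPG iteration (defined in the context) with these parameters, and suppose that the problem assumptions and the stochastic error assumption stated in the context hold. Then $$\|x_k-x_{\lambda_k}\|\to 0\quad\text{almost surely.}$$ Consequently, $\{x_k\}$ is almost surely bounded and $$\operatorname{dist}(x_k,S)\to 0\quad\text{almost surely.}$$ In particular, almost surely every limit point of $\{x_k\}$ belongs to $S$.
   Context: Setting. $X\subseteq\mathbb{R}^n$ is a nonempty closed convex set, $\|\cdot\|$ is the Euclidean norm, and $\mathbf{P}_X$ is the Euclidean projection onto $X$. $\xi:\Omega\to\mathbb{R}^d$ is a random vector on a probability space $(\Omega,\mathcal{F},\mathbb{P})$, $G:\mathbb{R}^n\times\mathbb{R}^d\to\mathbb{R}^n$ is measurable, and $F(x)=\mathbb{E}[G(x,\xi)]$ is well defined for every $x\in\mathbb{R}^n$. The stochastic inverse variational inequality (SIVI) is to find $x$ with $F(x)\in X$ and $\langle y-F(x),x\rangle\ge 0$ for all $y\in X$; its solution set is $$S=\{x\in\mathbb{R}^n:\ F(x)\in X,\ \langle y-F(x),x\rangle\ge 0\ \ \forall y\in X\}.$$ Problem assumptions. (i) $F:\mathbb{R}^n\to\mathbb{R}^n$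 is monotone ($\langle F(x)-F(y),x-y\rangle\ge0$ for all $x,y$) and $L_1$-Lipschitz continuous; (ii) $\Phi:\mathbb{R}^n\to\mathbb{R}^n$ is $\mu$-strongly monotone ($\langle \Phi(x)-\Phi(y),x-y\rangle\ge\mu\|x-y\|^2$ for all $x,y$, with $\mu>0$) and $L_2$-Lipschitz continuous; (iii) $S\neq\emptyset$. Regularization. For $\lambda>0$, $F_\lambda=F+\lambda\Phi$, and $x_\lambda$ denotes the unique point with $F_\lambda(x_\lambda)\in X$ and $\langle y-F_\lambda(x_\lambda),x_\lambda\rangle\ge 0$ for all $y\in X$ (existence and uniqueness hold because $F_\lambda$ is strongly monotone and Lipschitz). RVC-IPG iteration. Given $x_0\in\mathbb{R}^n$, positive parameters $\eta_k,\theta_k,\lambda_k$, positive integers $N_k$, and random samples $\xi_{j,k}$ of $\xi$ ($1\le j\le N_k$, $k\ge0$), set $\hat F_k=\frac1{N_k}\sum_{j=1}^{N_k}G(x_k,\xi_{j,k})+\lambda_k\Phi(x_k)$ and $$z_k=\mathbf{P}_X[\hat F_k-\eta_kx_k],\qquad x_{k+1}=x_k-\theta_k(\hat F_k-z_k),\qquad k\ge 0.$$ Stochastic error assumption. Let $\mathcal{F}_k=\sigma\{x_0,\xi_{j,s}:0\le s\le k-1,\ 1\le j\le N_s\}$ and $\bar w_{k,N_k}=\frac1{N_k}\sum_{j=1}^{N_k}(G(x_k,\xi_{j,k})-F(x_k))$. There exists $\nu>0$ such that for all $k$, almost surely, $\mathbb{E}[\bar w_{k,N_k}\mid\mathcal{F}_k]=0$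 and $\mathbb{E}[\|\bar w_{k,N_k}\|^2\mid\mathcal{F}_k]\le \nu^2/N_k$. $\operatorname{dist}(x,S)=\inf_{s\in S}\|x-s\|$. *)

(* Defs.v *)
From HB Require Import structures.
From mathcomp Require Import all_boot all_order all_algebra.
From mathcomp Require Import all_classical all_reals all_analysis.
Set Implicit Arguments.
Unset Strict Implicit.
Unset Printing Implicit Defensive.
Import Order.TTheory GRing.Theory Num.Theory.
Import numFieldNormedType.Exports.
Local Open Scope classical_set_scope.
Local Open Scope ring_scope.

(* The norm `|_| on 'rV[R]_n is the sup norm, hence [dotv] and [enorm]; the
   topology it induces is the usual one. *)

Section euclidean.
Context {R : realType} {n : nat}.
Implicit Types (u v x y z : 'rV[R]_n) (X S : set 'rV[R]_n).

Definition dotv u v : R := \sum_i u 0 i * v 0 i.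

Definition enorm u : R := Num.sqrt (dotv u u).

Definition edist_set x S : R := inf [set enorm (x - s) | s in S].

(* The choice of a minimizer is irrelevant when X is nonempty, closed and
   convex: it exists and is unique. *)
Definition eproj X v : 'rV[R]_n :=
  xget 0 [set z | X z /\ forall y, X y -> enorm (v - z) <= enorm (v - y)].

Definition monotone_op (f : 'rV[R]_n -> 'rV[R]_n) :=
  forall x y, 0 <= dotv (f x - f y) (x - y).

Definition strongly_monotone_op (mu : R) (f : 'rV[R]_n -> 'rV[R]_n) :=
  forall x y, mu * enorm (x - y) ^+ 2 <= dotv (f x - f y) (x - y).

Definition elipschitz (L : R) (f : 'rV[R]_n -> 'rV[R]_n) :=
  forall x y, enorm (f x - f y) <= L * enorm (x - y).

Definition ivi_sol X (f : 'rV[R]_n -> 'rV[R]_n) : set 'rV[R]_n :=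
  [set x | X (f x) /\ forall y, X y -> 0 <= dotv (y - f x) x].

(* x_lambda; as for [eproj], the choice is irrelevant when the regularized
   problem has a unique solution. *)
Definition ivi_reg X (F Phi : 'rV[R]_n -> 'rV[R]_n) (lambda : R) : 'rV[R]_n :=
  xget 0 (ivi_sol X (fun x => F x + lambda *: Phi x)).

End euclidean.

Notation borelV R n := (g_sigma_algebraType (@open 'rV[R]_n)).

Section iteration.
Context {R : realType} {n d : nat}.
Variables (X : set 'rV[R]_n) (G : 'rV[R]_n -> 'rV[R]_d -> 'rV[R]_n).
Variables (Phi : 'rV[R]_n -> 'rV[R]_n) (eta theta lambda : nat -> R).
Variable N : nat -> nat.

(* One trajectory, as a function of the initial point and of the realizations
   s j k of the samples xi_{j,k}, of which only those with 1 <= j <= N k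
   are used. *)
Fixpoint rvc_ipg (x0 : 'rV[R]_n) (s : nat -> nat -> 'rV[R]_d) (k : nat) :
    'rV[R]_n :=
  if k is k'.+1 then
    let x := rvc_ipg x0 s k' in
    let Fhat := (N k')%:R^-1 *: (\sum_(1 <= j < (N k').+1) G x (s j k'))
                + lambda k' *: Phi x in
    let z := eproj X (Fhat - eta k' *: x) in
    x - theta k' *: (Fhat - z)
  else x0.

End iteration.

Section stochastic.
Context {disp : measure_display} {T : measurableType disp} {R : realType}.
Variable P : probability T R.
Context {n d : nat}.

Definition meanV (Y : T -> 'rV[R]_n) : 'rV[R]_n :=
  \row_i fine 'E_P[fun w => Y w 0 i].

Definition integrableV (Y : T -> 'rV[R]_n) :=
  forall i, P.-integrable setT (fun w => (Y w 0 i)%:E).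

(* Y is a version of the conditional expectation of X given the
   sub-sigma-algebra H. *)
Definition is_cond_expectation (H : set (set T)) (X Y : T -> R) :=
  [/\ P.-integrable setT (fun w => (X w)%:E),
      P.-integrable setT (fun w => (Y w)%:E),
      (forall B : set R, measurable B -> H (Y @^-1` B)) &
      (forall A, H A ->
        \int[P]_(w in A) (X w)%:E = \int[P]_(w in A) (Y w)%:E)%E].

Definition history (N : nat -> nat) (x0 : {RV P >-> borelV R n})
    (xi : nat -> nat -> {RV P >-> borelV R d}) (k : nat) : set (set T) :=
  <<s g_sigma_algebra_preimage x0 `|`
      \bigcup_(s in [set s | (s < k)%N])
        \bigcup_(j in [set j | (1 <= j <= N s)%N])
          g_sigma_algebra_preimage (xi j s) >>.

Definition batch_error (G : 'rV[R]_n -> 'rV[R]_d -> 'rV[R]_n)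
    (F : 'rV[R]_n -> 'rV[R]_n) (N : nat -> nat)
    (xi : nat -> nat -> {RV P >-> borelV R d}) (x : nat -> T -> 'rV[R]_n)
    (k : nat) (w : T) : 'rV[R]_n :=
  (N k)%:R^-1 *: \sum_(1 <= j < (N k).+1) (G (x k w) (xi j k w) - F (x k w)).

Definition stochastic_error_assumption (H : nat -> set (set T))
    (N : nat -> nat) (e : nat -> T -> 'rV[R]_n) :=
  exists2 nu : R, 0 < nu & forall k : nat,
    (forall i, exists2 Y, is_cond_expectation (H k) (fun w => e k w 0 i) Y &
       {ae P, forall w, Y w = 0}) /\
    (exists2 Y, is_cond_expectation (H k) (fun w => enorm (e k w) ^+ 2) Y &
       {ae P, forall w, Y w <= nu ^+ 2 / (N k)%:R}).

End stochastic.

(* Main.v *)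
Require Import Defs.
From mathcomp Require Import all_boot all_order all_algebra.
From mathcomp Require Import all_classical all_reals all_analysis.
From mathcomp Require Import measurable_realfun.
From mathcomp Require Import ring lra.
Set Implicit Arguments.
Unset Strict Implicit.
Unset Printing Implicit Defensive.
Import Order.TTheory GRing.Theory Num.Theory.
Import numFieldNormedType.Exports.
Local Open Scope classical_set_scope.
Local Open Scope ring_scope.

(** The proof compares three sequences: the random iterates [x_k], the iterates
    [y_k] obtained from the same starting point when the batch means are replaced
    by the expectation [F] ([mean_path]), and the solutions [x_lambda_k] of the
    regularized problems ([ivi_reg]).

    Everything rests on one inequality for a single step
    ([ipg_step_contraction]).  Adding the variational inequalities of the
    projections made by two runs of the method, the first with an error [e] on
    the operator value and the second without, one finds that the squared
    distance of the runs is multiplied by at most [1 - theta lambda mu], up to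
    the terms [2 (theta / eta) |e|^2] and [- 2 theta <x - y, e>].  The error thus
    contributes to first order only through an inner product with the deviation
    [x - y], and no bias is caused by the nonlinearity of the projection.

    Random part, [x_k - y_k].  This deviation vanishes at [k = 0] and is a
    function of the history, whereas the error has conditional mean zero.  The
    inner product therefore has mean zero ([integral_mul_eq0]), and
    [v_k = E |x_k - y_k|^2] satisfies
    [v_(k+1) <= (1 - c (k+1)^-(p+r)) v_k + C (k+1)^-(r+q+1+delta)]
    ([mean_sqr_dev_step]).  Chung's lemma ([chung_rate]) gives
    [v_k = O((k+1)^-(1+delta+q-p))].  As [p <= q], this is summable, so that
    [x_k - y_k] tends to [0] almost surely by monotone convergence
    ([ae_cvg0_summable]).  The comparison with [y_k] is what makes this rate
    possible: the distance to the moving target [x_lambda_k] need not be square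
    summable.

    Deterministic part, [y_k - x_lambda_k].  Since [x_lambda_k] is a fixed point
    of the [k]-th noiseless step, this step contracts the distance to it by
    [1 - c (k+1)^-(p+r) / 2], and the target then moves by [O(1/(k+1))]
    ([ivi_reg_dist]).  As [p + r < 1], Chung's lemma again gives convergence to
    [0] ([mean_path_tracks]).  The existence of [x_lambda] itself follows from
    the contraction of a step ([ivi_sol_exists]).

    Consequences.  The points [x_lambda] are bounded ([ivi_reg_dist_sol]) and
    their cluster points as [lambda] tends to [0] solve the original problem
    ([ivi_reg_limit]); by compactness their distance to the solution set tends
    to [0] ([ivi_reg_dist_sols_cvg]).  Boundedness of the iterates, convergence
    of their distance to the solutions and the statement on limit points follow
    for every trajectory that satisfies the first convergence. *)

(** * Euclidean geometry of row vectors *)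

Section euclidean_space.
Context {R : realType} {n : nat}.
Implicit Types (u v w x y : 'rV[R]_n) (a : R).

Lemma dotvC u v : dotv u v = dotv v u.
Proof. by apply: eq_bigr => i _; rewrite mulrC. Qed.

Lemma dotvDl u v w : dotv (u + v) w = dotv u w + dotv v w.
Proof. by rewrite -big_split; apply: eq_bigr => i _; rewrite mxE mulrDl. Qed.

Lemma dotvZl a u v : dotv (a *: u) v = a * dotv u v.
Proof. by rewrite mulr_sumr; apply: eq_bigr => i _; rewrite mxE mulrA. Qed.

Lemma dotvNl u v : dotv (- u) v = - dotv u v.
Proof. by rewrite -scaleN1r dotvZl mulN1r. Qed.

Lemma dotvBl u v w : dotv (u - v) w = dotv u w - dotv v w.
Proof. by rewrite dotvDl dotvNl. Qed.

Lemma dotvDr u v w : dotv w (u + v) = dotv w u + dotv w v.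
Proof. by rewrite dotvC dotvDl !(dotvC w). Qed.

Lemma dotvZr a u v : dotv v (a *: u) = a * dotv v u.
Proof. by rewrite dotvC dotvZl dotvC. Qed.

Lemma dotvNr u v : dotv v (- u) = - dotv v u.
Proof. by rewrite dotvC dotvNl dotvC. Qed.

Definition dotvE := (dotvDl, dotvDr, dotvNl, dotvNr, dotvZl, dotvZr).

Lemma dotv0l u : dotv 0 u = 0.
Proof. by rewrite -(scale0r u) dotvZl mul0r. Qed.

Lemma dotv_sqrB u v : dotv (u - v) (u - v) = dotv u u - 2 * dotv u v + dotv v v.
Proof. by rewrite !dotvE (dotvC v u); ring. Qed.

Lemma dotv_ge0 u : 0 <= dotv u u.
Proof. by apply: sumr_ge0 => i _; rewrite -expr2 sqr_ge0. Qed.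

Lemma enorm_ge0 u : 0 <= enorm u.
Proof. exact: sqrtr_ge0. Qed.

Lemma sqr_enorm u : enorm u ^+ 2 = dotv u u.
Proof. by rewrite sqr_sqrtr// dotv_ge0. Qed.

Lemma enorm0 : enorm (0 : 'rV[R]_n) = 0.
Proof. by rewrite /enorm dotv0l sqrtr0. Qed.

Lemma enormZ a u : enorm (a *: u) = `|a| * enorm u.
Proof.
by rewrite /enorm dotvZl dotvZr mulrA -expr2 sqrtrM ?sqr_ge0// sqrtr_sqr.
Qed.

Lemma enormN u : enorm (- u) = enorm u.
Proof. by rewrite /enorm dotvNl dotvNr opprK. Qed.

Lemma enormB u v : enorm (u - v) = enorm (v - u).
Proof. by rewrite -enormN opprB. Qed.

Lemma coord_le_enorm u i : `|u 0 i| <= enorm u.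
Proof.
rewrite -ler_sqr ?nnegrE ?enorm_ge0// sqr_enorm real_normK ?num_real//.
rewrite /dotv (bigD1 i)//= -expr2 lerDl.
by apply: sumr_ge0 => j _; rewrite -expr2 sqr_ge0.
Qed.

Lemma normr_le_enorm u : `|u| <= enorm u.
Proof.
rewrite /Num.Def.normr/= mx_normrE; apply/bigmax_leP; split; first exact: enorm_ge0.
by move=> [i j] _ /=; rewrite ord1 coord_le_enorm.
Qed.

Lemma coord_le_normr u i : `|u 0 i| <= `|u|.
Proof.
by rewrite [leRHS]/Num.Def.normr/= mx_normrE; apply/bigmax_geP; right; exists (0, i).
Qed.

Lemma enorm_le_normr u : enorm u <= n%:R * `|u|.
Proof.
rewrite -ler_sqr ?nnegrE ?enorm_ge0 ?mulr_ge0// sqr_enorm.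
apply: (@le_trans _ _ (n%:R * `|u| ^+ 2)).
  rewrite /dotv -[n in n%:R]card_ord -sum1_card natr_sum mulr_suml.
  apply: ler_sum => i _; rewrite mul1r -expr2 -[u 0 i ^+ 2]real_normK ?num_real//.
  by rewrite ler_sqr ?nnegrE// coord_le_normr.
rewrite exprMn ler_wpM2r ?sqr_ge0// -natrX ler_nat.
by case: n => // m; rewrite leq_pmulr.
Qed.

Lemma enorm_eq0 u : enorm u = 0 -> u = 0.
Proof.
move=> u0; apply/eqP; rewrite -normr_le0; apply: le_trans (normr_le_enorm u) _.
by rewrite u0.
Qed.

Lemma cauchy_schwarz u v : dotv u v <= enorm u * enorm v.
Proof.
have [->|u0] := eqVneq u 0; first by rewrite dotv0l enorm0 mul0r.
have [->|v0] := eqVneq v 0; first by rewrite dotvC dotv0l enorm0 mulr0.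
have pu : 0 < enorm u.
  by rewrite lt_neqAle enorm_ge0 andbT eq_sym; apply: contra_neq u0; exact: enorm_eq0.
have pv : 0 < enorm v.
  by rewrite lt_neqAle enorm_ge0 andbT eq_sym; apply: contra_neq v0; exact: enorm_eq0.
(* the squared norm of |v| u - |u| v is nonnegative *)
have := dotv_ge0 (enorm v *: u - enorm u *: v).
rewrite !dotvE -!sqr_enorm (dotvC v u) => h.
rewrite -(ler_pM2l (mulr_gt0 pu pv)); nra.
Qed.

(** [dotv (2a u - v) (2a u - v)] is nonnegative; expand it and divide by [4a]. *)
Lemma dotv_le_young a u v : 0 < a ->
  dotv u v <= a * dotv u u + (4 * a)^-1 * dotv v v.
Proof.
move=> a0; have := dotv_ge0 ((2 * a) *: u - v).
rewrite !dotvE (dotvC v u) => h.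
have a4 : 0 < (4 * a)^-1 by rewrite invr_gt0 mulr_gt0.
have : 0 <= (4 * a)^-1 * (2 * a * (2 * a * dotv u u) + - (2 * a * dotv u v) +
   (- (2 * a * dotv u v) - - dotv v v)) by rewrite mulr_ge0 ?(ltW a4)//; lra.
move=> h2; rewrite -subr_ge0; apply: le_trans h2 _.
by rewrite le_eqVlt; apply/orP; left; apply/eqP; field; lra.
Qed.

Lemma enormD u v : enorm (u + v) <= enorm u + enorm v.
Proof.
rewrite -ler_sqr ?nnegrE ?addr_ge0 ?enorm_ge0//.
rewrite sqr_enorm !dotvE sqrrD !sqr_enorm (dotvC v u).
by have := cauchy_schwarz u v; lra.
Qed.

Lemma enorm_distD w u v : enorm (u - v) <= enorm (u - w) + enorm (w - v).
Proof. by have := enormD (u - w) (w - v); rewrite addrA subrK. Qed.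

Lemma enorm_lipschitz_continuous (V : normedModType R) L (f : 'rV[R]_n -> V) :
  (forall x y, `|f x - f y| <= L * enorm (x - y)) -> continuous f.
Proof.
move=> Lf x; apply/(@cvgrPdist_lt _ _ _ (nbhs x) (nbhs_filter x)) => e e0.
pose K := (`|L| * n%:R) + 1.
have K0 : 0 < K by rewrite ltr_wpDl// mulr_ge0.
have := nbhsx_ballx x _ (divr_gt0 e0 K0); apply: filterS => y.
rewrite -ball_normE/= => xy.
apply: le_lt_trans (Lf _ _) _.
apply: (@le_lt_trans _ _ (K * `|x - y|)); last by rewrite mulrC -ltr_pdivlMr.
apply: (@le_trans _ _ (`|L| * (n%:R * `|x - y|))).
  apply: le_trans (ler_wpM2r (enorm_ge0 _) (ler_norm L)) _.
  by rewrite ler_wpM2l// enorm_le_normr.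
by rewrite mulrA ler_wpM2r// lerDl.
Qed.

Lemma elipschitz_continuous L (f : 'rV[R]_n -> 'rV[R]_n) :
  elipschitz L f -> continuous f.
Proof.
move=> Lf; apply: (@enorm_lipschitz_continuous _ L) => x y.
exact: le_trans (normr_le_enorm _) (Lf _ _).
Qed.

Lemma enorm_dist_lipschitz u v x :
  `|enorm (u - x) - enorm (v - x)| <= enorm (u - v).
Proof.
have := enorm_distD v u x; have := enorm_distD u v x.
by rewrite (enormB v u) ler_norml => h1 h2; apply/andP; split; lra.
Qed.

Lemma nbhs_enorm_ball x (e : R) : 0 < e -> nbhs x [set y | enorm (y - x) < e].
Proof.
move=> e0; have n0 : 0 < n%:R + 1 :> R by rewrite ltr_wpDl.
have := nbhsx_ballx x _ (divr_gt0 e0 n0); apply: filterS => y.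
rewrite -ball_normE/= => xy; rewrite enormB.
apply: le_lt_trans (enorm_le_normr _) _.
apply: (@le_lt_trans _ _ ((n%:R + 1) * `|x - y|)); last by rewrite mulrC -ltr_pdivlMr.
by rewrite ler_wpM2r// lerDl.
Qed.

Lemma compact_enorm_ball x (r : R) : compact [set y | enorm (y - x) <= r].
Proof.
apply: bounded_closed_compact.
  exists (`|x| + r); split; first exact: num_real.
  move=> M rM y /= xy; apply: ltW; apply: le_lt_trans rM.
  have -> : y = x + (y - x) by rewrite addrC subrK.
  apply: le_trans (ler_normD _ _) _.
  by rewrite lerD2l (le_trans (normr_le_enorm _) xy).
apply: (@preimage_closed _ _ (fun y => enorm (y - x)) [set t | t <= r]).
  move=> y _; apply: (@enorm_lipschitz_continuous R 1) => {}y z.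
  by rewrite mul1r enorm_dist_lipschitz.
exact: closed_le.
Qed.

End euclidean_space.

(** * Projections and the contraction of one step *)

Section projection.
Context {R : realType} {n : nat}.
Variable X : set 'rV[R]_n.
Hypotheses (X0 : X !=set0) (closedX : closed X).
Implicit Types (u v w x y : 'rV[R]_n).

Lemma eproj_spec v :
  X (eproj X v) /\ forall y, X y -> enorm (v - eproj X v) <= enorm (v - y).
Proof.
suff : exists z, X z /\ forall y, X y -> enorm (v - z) <= enorm (v - y).
  move=> h; pose M := [set z | X z /\ forall y, X y -> enorm (v - z) <= enorm (v - y)].
  exact: (@xgetPex _ 0 M h).
have [s Xs] := X0.
have cf : continuous (fun y : 'rV[R]_n => enorm (v - y)).
  apply: (@enorm_lipschitz_continuous _ _ R 1) => x y.
  by rewrite mul1r !(enormB v) enorm_dist_lipschitz.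
pose K := [set y | enorm (y - v) <= enorm (v - s)] `&` X.
have cK : compact K by apply: compact_closedI => //; exact: compact_enorm_ball.
have K0 : K !=set0 by exists s; split => //=; rewrite enormB.
have [z /set_mem[/= vz Xz] zP] := compact_EVT_min K0 cK (continuous_subspaceT cf).
exists z; split=> // y Xy; have [vy|/ltW vy] := leP (enorm (v - y)) (enorm (v - s)).
  by apply: zP; apply/mem_set; split=> //=; rewrite (enormB y).
by rewrite (enormB z) in vz; exact: le_trans vy.
Qed.

Hypothesis convexX : convex_set X.

Lemma convex_set_segment u v (t : R) : 0 <= t -> t <= 1 -> X u -> X v ->
  X (u + t *: (v - u)).
Proof.
move=> t0 t1 Xu Xv.
have -> : u + t *: (v - u) = t *: v + (1 - t) *: u.
  by apply/rowP => i; rewrite !mxE; ring.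
by have := @convexX _ _ (Itv01 t0 t1) (mem_set Xv) (mem_set Xu); rewrite inE.
Qed.

(** First-order optimality: moving from the projection towards a point of [X]
    by a small fraction cannot decrease the distance. *)
Lemma eproj_variational v y : X y ->
  dotv (v - eproj X v) (y - eproj X v) <= 0.
Proof.
move=> Xy; have [Xz zmin] := eproj_spec v; set z := eproj X v in Xz zmin *.
set a := dotv _ _; set b := dotv (y - z) (y - z).
rewrite leNgt; apply/negP => a0; have b0 : 0 <= b by exact: dotv_ge0.
have ab0 : 0 < a + b by rewrite ltr_wpDr.
pose t := a / (a + b).
have t0 : 0 < t by exact: divr_gt0.
have t1 : t <= 1 by rewrite ler_pdivrMr// mul1r lerDl.
have := zmin _ (convex_set_segment (ltW t0) t1 Xz Xy).
rewrite -ler_sqr ?nnegrE ?enorm_ge0// !sqr_enorm opprD addrA.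
rewrite (dotv_sqrB (v - z)) dotvZl !dotvZr -/a -/b => h.
have tab : t * (a + b) = a by rewrite /t divfK// gt_eqF.
have : t * (2 * a) <= t * (t * b) by lra.
rewrite ler_pM2l// => h2.
have : 0 < t * a by exact: mulr_gt0.
lra.
Qed.

Lemma eproj_nonexpansive v w :
  enorm (eproj X v - eproj X w) <= enorm (v - w).
Proof.
set z := eproj X v; set z' := eproj X w.
have := eproj_variational v (eproj_spec w).1.
have := eproj_variational w (eproj_spec v).1.
rewrite -/z -/z'; move: z z' => z z' h1 h2.
have h3 : enorm (z - z') ^+ 2 <= dotv (v - w) (z - z').
  move: h1 h2; rewrite sqr_enorm !dotvE (dotvC z' z); lra.
have := le_trans h3 (cauchy_schwarz _ _).
have := enorm_ge0 (z - z'); rewrite le_eqVlt => /predU1P[<- _|e0].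
  exact: enorm_ge0.
by rewrite expr2 ler_pM2r.
Qed.

Lemma eproj_continuous : continuous (eproj X).
Proof.
apply: (@elipschitz_continuous _ _ 1) => x y.
by rewrite mul1r eproj_nonexpansive.
Qed.

(** One step of the method when [a] is the value returned for the regularized
    operator at [x]. *)
Definition ipg_step (theta eta : R) (a x : 'rV[R]_n) : 'rV[R]_n :=
  x - theta *: (a - eproj X (a - eta *: x)).

(** The squared distance of two runs contracts by a factor [1 - theta m], and
    the error [e] made by the first run enters linearly only through its inner
    product with [x - y], which has mean zero when [e] has conditional mean
    zero.  Although the projection is nonlinear, its bias appears only at second
    order.  With [D], [A] and [U] the differences of the points, of the operator
    values and of the residuals, adding the variational inequalities of the two
    projections gives [0 <= dotv (U - eta D) (A + e - U)]; this bounds the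
    decrease [eta dotv D U] from below, and Young's inequality absorbs [dotv U A]
    and [dotv U e] into [dotv U U]. *)
Lemma ipg_step_contraction theta eta m L x y a b e :
    0 < theta -> 0 < eta -> 2 * (eta * theta) <= 1 -> L ^+ 2 <= eta * m ->
    0 <= L ->
    enorm (a - b) <= L * enorm (x - y) ->
    m * enorm (x - y) ^+ 2 <= dotv (a - b) (x - y) ->
  enorm (ipg_step theta eta (a + e) x - ipg_step theta eta b y) ^+ 2 <=
  (1 - theta * m) * enorm (x - y) ^+ 2 + 2 * (theta / eta) * enorm e ^+ 2
  - 2 * theta * dotv (x - y) e.
Proof.
move=> th0 eta0 etath Lm L0 Lab mab.
have h1 := eproj_variational (a + e - eta *: x)
  (eproj_spec (b - eta *: y)).1.
have h2 := eproj_variational (b - eta *: y)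
  (eproj_spec (a + e - eta *: x)).1.
rewrite /ipg_step; move: h1 h2.
move: (eproj X (a + e - _)) (eproj X (b - _)) => z z' h1 h2.
pose D := x - y; pose A := a - b; pose U := (a + e - z) - (b - z').
have zz' : 0 <= dotv (U - eta *: D) (A + e - U).
  have -> : A + e - U = z - z'.
    by apply/rowP => i; rewrite !mxE; ring.
  have -> : U - eta *: D = (a + e - eta *: x - z) - (b - eta *: y - z').
    by apply/rowP => i; rewrite !mxE; ring.
  rewrite (dotvBl (a + e - eta *: x - z)).
  by move: h1; rewrite -(opprB z z') dotvNr; lra.
have -> : x - theta *: (a + e - z) - (y - theta *: (b - z')) = D - theta *: U.
  by apply/rowP => i; rewrite !mxE; ring.
rewrite -/A -/D in Lab mab *; clearbody D A U => {h1 h2}.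
have AA : dotv A A <= L ^+ 2 * dotv D D.
  rewrite -!sqr_enorm -exprMn ler_sqr ?nnegrE ?enorm_ge0//.
  by rewrite mulr_ge0 ?enorm_ge0.
(* the weights 1/2 and 1/4 leave a quarter of [dotv U U], which pays for the
   term [theta ^+ 2 * dotv U U] *)
have half0 : 0 < 2^-1 :> R by rewrite invr_gt0.
have UA := dotv_le_young U A half0.
have quarter0 : 0 < 4^-1 :> R by rewrite invr_gt0.
have Ue := dotv_le_young U e quarter0.
have k2 : (4 * 2^-1)^-1 = 2^-1 :> R by field.
have k1 : (4 * 4^-1)^-1 = 1 :> R by field.
rewrite k2 in UA; rewrite k1 mul1r in Ue.
rewrite sqr_enorm (dotvC A D) in mab.
rewrite !dotvE in zz'.
rewrite !sqr_enorm dotv_sqrB !dotvZl !dotvZr.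
have UU := dotv_ge0 U.
have LDD : L ^+ 2 * dotv D D <= eta * m * dotv D D by rewrite ler_wpM2r ?dotv_ge0.
have tUU : 2 * (eta * theta) * dotv U U <= 1 * dotv U U by rewrite ler_wpM2r.
have mDD : eta * (m * dotv D D) <= eta * dotv D A by rewrite ler_pM2l.
have [k k0 thE] : exists2 k, 0 < k & theta = k * eta.
  by exists (theta / eta); rewrite ?divr_gt0// divfK// gt_eqF.
rewrite thE mulfK ?gt_eqF//; rewrite thE in tUU.
rewrite -subr_ge0.
set rhs := (X in 0 <= X).
have -> : rhs = k * (2 * (eta * dotv D U) - eta * (k * eta) * dotv U U
    - eta * m * dotv D D + 2 * dotv e e - 2 * (eta * dotv D e)).
  by rewrite /rhs; ring.
apply: mulr_ge0; first exact: ltW.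
lra.
Qed.

End projection.

(** * Inverse variational inequalities as fixed point problems *)

Section inverse_variational_inequality.
Context {R : realType} {n : nat}.
Variable X : set 'rV[R]_n.
Implicit Types (u v w x y : 'rV[R]_n) (f g : 'rV[R]_n -> 'rV[R]_n).

(** Each solution is tested against the operator value of the other one. *)
Lemma ivi_sol_cross f g x x' : ivi_sol X f x -> ivi_sol X g x' ->
  0 <= dotv (f x - g x') (x' - x).
Proof.
move=> [Xfx xP] [Xgx' x'P]; have := xP _ Xgx'; have := x'P _ Xfx.
by rewrite !dotvE; lra.
Qed.

(** On the ball around [0] that a contraction [t] maps into itself, a
    minimizer [c] of the displacement [enorm (t c - c)] must be a fixed point,
    since [t c] has a smaller displacement. *)
Lemma econtraction_fixpoint (t : 'rV[R]_n -> 'rV[R]_n) (k : R) :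
    0 <= k < 1 -> (forall x y, enorm (t x - t y) <= k * enorm (x - y)) ->
  exists x, t x = x.
Proof.
move=> /andP[k0 k1] tk.
pose r := enorm (t 0) / (1 - k).
have kr : k * r + enorm (t 0) = r by rewrite /r; field; rewrite subr_eq0 gt_eqF.
pose K := [set x : 'rV[R]_n | enorm (x - 0) <= r].
have r0 : 0 <= r by rewrite divr_ge0 ?enorm_ge0// subr_ge0 ltW.
have cf : continuous (fun x : 'rV[R]_n => enorm (t x - x)).
  apply: (@enorm_lipschitz_continuous _ _ R (k + 1)) => x y.
  have := enorm_dist_lipschitz (t x - x) (t y - y) 0; rewrite !subr0.
  move/le_trans; apply.
  have -> : t x - x - (t y - y) = (t x - t y) + (y - x).
    by apply/rowP => i; rewrite !mxE; ring.
  apply: le_trans (enormD _ _) _; rewrite mulrDl mul1r (enormB y) lerD2r.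
  exact: tk.
have cK : compact K by exact: compact_enorm_ball.
have K0 : K !=set0 by exists 0; rewrite /K/= subr0 enorm0.
have [c /set_mem Kc cP] := compact_EVT_min K0 cK (continuous_subspaceT cf).
exists c; apply/subr0_eq/enorm_eq0.
rewrite /K/= subr0 in Kc; have Ktc : K (t c).
  have := enorm_distD (t 0) (t c) 0; have := tk c 0; rewrite !subr0 => h1 h2.
  have : k * enorm c <= k * r by rewrite ler_wpM2l.
  by rewrite /K/= subr0; lra.
have /= cmin := cP _ (mem_set Ktc).
apply/eqP; rewrite eq_le enorm_ge0 andbT.
have : (1 - k) * enorm (t c - c) <= 0 by have := tk (t c) c; lra.
by rewrite pmulr_rle0// subr_gt0.
Qed.

Hypotheses (X0 : X !=set0) (closedX : closed X) (convexX : convex_set X).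

(** The projection of [f x - eta x] is [f x] exactly when the optimality
    condition [dotv (- eta x) (y - f x) <= 0] holds on [X]. *)
Lemma ivi_sol_fixpoint f eta theta x : 0 < eta -> 0 < theta ->
  ivi_sol X f x <-> ipg_step X theta eta (f x) x = x.
Proof.
move=> eta0 theta0; rewrite /ipg_step; set z := eproj X _.
have zP y : X y -> dotv (f x - eta *: x - z) (y - z) <= 0.
  exact: eproj_variational.
have Xz : X z by exact: (eproj_spec X0 closedX _).1.
clearbody z; split=> [[Xfx xP]|].
  suff -> : f x - z = 0 by rewrite scaler0 subr0.
  apply: enorm_eq0; apply/eqP; rewrite -sqrf_eq0 eq_le sqr_ge0 andbT sqr_enorm.
  have := zP _ Xfx; have := mulr_ge0 (ltW eta0) (xP _ Xz).
  rewrite -[z - f x]opprB dotvNl addrAC (dotvBl (f x - z)) dotvZl.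
  by rewrite (dotvC x); lra.
move/eqP; rewrite subr_eq -subr_eq0 opprD addNKr oppr_eq0 scaler_eq0.
rewrite gt_eqF//= subr_eq0 => /eqP fxz; rewrite fxz in zP *; split=> [|y Xy].
  by rewrite fxz.
have := zP _ Xy; rewrite addrAC subrr add0r dotvNl dotvZl oppr_le0.
by rewrite pmulr_rge0// dotvC fxz.
Qed.

(** [1 - u <= (1 - u / 2) ^+ 2] turns the contraction of the squared distance
    into one of the distance. *)
Lemma ipg_step_econtraction theta eta m L x y a b :
    0 < theta -> 0 < eta -> 2 * (eta * theta) <= 1 -> L ^+ 2 <= eta * m ->
    0 <= L -> 0 <= theta * m <= 1 ->
    enorm (a - b) <= L * enorm (x - y) ->
    m * enorm (x - y) ^+ 2 <= dotv (a - b) (x - y) ->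
  enorm (ipg_step X theta eta a x - ipg_step X theta eta b y) <=
  (1 - theta * m / 2) * enorm (x - y).
Proof.
move=> th0 eta0 etath Lm L0 /andP[thm0 thm1] Lab mab.
have k0 : 0 <= 1 - theta * m / 2 by lra.
have := ipg_step_contraction X0 closedX convexX 0 th0 eta0 etath Lm L0 Lab mab.
rewrite addr0 enorm0 expr0n mulr0 addr0 dotvC dotv0l mulr0 subr0 => h.
rewrite -ler_sqr ?nnegrE ?mulr_ge0 ?enorm_ge0//.
apply: (le_trans h); rewrite exprMn ler_wpM2r ?sqr_ge0//.
by have := sqr_ge0 (theta * m); lra.
Qed.

(** Solutions are the fixed points of the step, which contracts once [eta] is
    large and [theta] small. *)
Lemma ivi_sol_exists f (m L : R) : 0 < m -> 0 <= L ->
    strongly_monotone_op m f -> elipschitz L f ->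
  exists x, ivi_sol X f x.
Proof.
move=> m0 L0 mf Lf.
(* the summand [m] in [eta] keeps [theta * m] below 1/2 *)
pose eta := L ^+ 2 / m + m; pose theta := (2 * eta)^-1.
have eta0 : 0 < eta by rewrite ltr_wpDl// divr_ge0 ?sqr_ge0// ltW.
have theta0 : 0 < theta by rewrite invr_gt0 mulr_gt0.
have thm : theta * m <= 1 / 2.
  rewrite /theta mulrC ler_pdivrMr ?mulr_gt0//.
  have : 0 <= L ^+ 2 / m by rewrite divr_ge0 ?sqr_ge0// ltW.
  by rewrite /eta; lra.
have thm0 : 0 < theta * m by exact: mulr_gt0.
have [||c cE] := @econtraction_fixpoint
    (fun x => ipg_step X theta eta (f x) x) (1 - theta * m / 2); last 1 first.
- by exists c; apply/(ivi_sol_fixpoint f c eta0 theta0).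
- by apply/andP; split; lra.
- move=> x y; apply: ipg_step_econtraction L0 _ (Lf x y) (mf x y) => //.
  + by rewrite mulrA /theta divff// gt_eqF// mulr_gt0.
  + by rewrite /eta mulrDl divfK ?gt_eqF// lerDl -expr2 sqr_ge0.
  + by apply/andP; split; lra.
Qed.

End inverse_variational_inequality.

(** * Real sequences with power rates *)

Section real_sequences.
Context {R : realType}.
Implicit Types (c C s t u x : R) (v : nat -> R) (k : nat).

(** Bernoulli inequality for nonpositive real exponents. *)
Lemma powR_bernoulli x u : -1 < x -> 0 <= u -> 1 - u * x <= (1 + x) `^ (- u).
Proof.
move=> x1 u0; have x10 : 0 < 1 + x by lra.
rewrite /powR gt_eqF//; apply: le_trans (expR_ge1Dx _).
by rewrite mulNr lerD2l lerN2 ler_wpM2l// le_ln1Dx.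
Qed.

Lemma powR_nat_gt0 k u : 0 < k.+1%:R `^ u :> R.
Proof. exact: powR_gt0. Qed.

Lemma powRD_nat k s t : k.+1%:R `^ (s + t) = k.+1%:R `^ s * k.+1%:R `^ t :> R.
Proof. by rewrite powRD// pnatr_eq0 implybT. Qed.

Lemma powR_nat_le1 k u : 0 <= u -> k.+1%:R `^ (- u) <= 1 :> R.
Proof.
move=> u0; have k1 : 1 <= k.+1%:R :> R by rewrite ler1n.
have u0' : - u <= 0 by rewrite oppr_le0.
by have := ler_powR k1 u0'; rewrite powRr0.
Qed.

Lemma powR_nat_ge1 k u : 0 <= u -> 1 <= k.+1%:R `^ u :> R.
Proof.
move=> u0; have k1 : 1 <= k.+1%:R :> R by rewrite ler1n.
by have := ler_powR k1 u0; rewrite powRr0.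
Qed.

Lemma powR_nat_succ_ge k u : 0 <= u ->
  k.+1%:R `^ (- u) * (1 - u / k.+1%:R) <= k.+2%:R `^ (- u) :> R.
Proof.
move=> u0; have k0 : 0 < k.+1%:R :> R by rewrite ltr0n.
have ki0 : 0 < k.+1%:R^-1 :> R by rewrite invr_gt0.
have -> : k.+2%:R = k.+1%:R * (1 + k.+1%:R^-1) :> R.
  by rewrite mulrDr mulr1 divff ?gt_eqF// natr1.
rewrite powRM//.
rewrite ler_wpM2l ?powR_ge0//; move: ki0; move: (_^-1) => x x0.
by apply: powR_bernoulli => //; lra.
Qed.

Lemma powR_nat_pred_ge k u : 0 <= u ->
  k.+2%:R `^ (- u) * (1 + u / k.+2%:R) <= k.+1%:R `^ (- u) :> R.
Proof.
move=> u0; have k0 : 0 < k.+2%:R :> R by rewrite ltr0n.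
have ki0 : k.+2%:R^-1 < 1 :> R by rewrite invf_lt1// ltr1n.
have -> : k.+1%:R = k.+2%:R * (1 - k.+2%:R^-1) :> R.
  by rewrite mulrBr mulr1 divff ?gt_eqF// -[k.+2%:R]natr1 addrK.
rewrite powRM ?subr_ge0//; last exact: ltW.
rewrite ler_wpM2l ?powR_ge0//; move: ki0; move: (_^-1) => x x1.
by have := @powR_bernoulli (- x) u; rewrite mulrN opprK; apply=> //; lra.
Qed.

(** [u * k.+2 `^ - (1 + u)] is at most the difference of consecutive values of
    [k.+1 `^ - u], so that the sum telescopes. *)
Lemma powR_nat_sum_le u n : 0 < u ->
  \sum_(0 <= k < n) k.+1%:R `^ (- (1 + u)) <= 1 + u^-1 :> R.
Proof.
move=> u0.
have ui0 : 0 < u^-1 by rewrite invr_gt0.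
case: n => [|n]; first by rewrite big_geq// addr_ge0// ltW.
suff h : \sum_(0 <= k < n.+1) k.+1%:R `^ (- (1 + u)) <=
         1 + u^-1 - u^-1 * n.+1%:R `^ (- u) :> R.
  apply: (le_trans h); rewrite gerBl mulr_ge0 ?powR_ge0// ltW//.
elim: n => [|n ih].
  by rewrite big_nat1 !powR1 mulr1 addrK.
rewrite big_nat_recr//=.
have : n.+2%:R `^ (- (1 + u)) <=
    u^-1 * n.+1%:R `^ (- u) - u^-1 * n.+2%:R `^ (- u) :> R.
  have := powR_nat_pred_ge n (ltW u0).
  rewrite opprD powRD_nat powR_inv1//.
  move/(ler_wpM2l (ltW ui0)); rewrite mulrDr mulr1 mulrDr.
  have -> : u^-1 * (n.+2%:R `^ (- u) * (u / n.+2%:R)) =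
            n.+2%:R^-1 * n.+2%:R `^ (- u) :> R.
    have : n.+2%:R != 0 :> R by rewrite pnatr_eq0.
    by move: n.+2%:R => a a0; field; rewrite a0 gt_eqF.
  by rewrite lerBrDl.
by lra.
Qed.

Lemma powR_nat_eventually_le u e : 0 < u -> 0 < e ->
  exists n, forall k, (n <= k)%N -> k.+1%:R `^ (- u) <= e :> R.
Proof.
move=> u0 e0; exists (Num.trunc (e^-1 `^ u^-1)) => k nk.
rewrite powRN -[e]invrK lef_pV2 ?posrE ?powR_gt0 ?invr_gt0 ?ltr0n//.
have -> : e^-1 = (e^-1 `^ u^-1) `^ u.
  by rewrite -powRrM mulVf ?gt_eqF// powRr1// invr_ge0 ltW.
apply: ge0_ler_powR; rewrite ?nnegrE ?powR_ge0 ?ler0n ?ltW//.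
by rewrite -truncn_le_nat.
Qed.

(** Chung's lemma on perturbed contractions.  The sequence [(k + 1) ^ (s - t)]
    decreases only by factors [1 - (t - s) / (k + 1)], a slower rate than
    [1 - c / (k + 1) ^ s] because [s < 1]; from some rank on, half of the
    contraction therefore suffices to follow it, and the other half pays for the
    perturbation. *)
Lemma chung_rate c C s t v : 0 < c <= 1 -> 0 <= C -> 0 < s < 1 -> s < t ->
    (forall k, v k.+1 <=
      (1 - c * k.+1%:R `^ (- s)) * v k + C * k.+1%:R `^ (- t)) ->
  exists M : R, forall k, v k <= M * k.+1%:R `^ (- (t - s)).
Proof.
move=> /andP[c0 c1] C0 /andP[s0 s1] st vrec.
pose u := t - s; have u0 : 0 < u by rewrite subr_gt0.
have c2u : 0 < c / (2 * u) by rewrite divr_gt0// mulr_gt0.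
have s10 : 0 < 1 - s by rewrite subr_gt0.
have [n nP] := powR_nat_eventually_le s10 c2u.
(* the sum makes the bound hold up to rank [n] *)
pose M := 2 * C / c + \sum_(0 <= k < n.+1) `|v k| * k.+1%:R `^ u.
have M1 : 0 <= \sum_(0 <= k < n.+1) `|v k| * k.+1%:R `^ u.
  by apply: sumr_ge0 => k _; rewrite mulr_ge0 ?powR_ge0.
have M0 : 0 <= M by rewrite addr_ge0// divr_ge0 ?mulr_ge0// ltW.
have CM : 2 * C <= M * c by rewrite -ler_pdivrMr// lerDl.
have small k : (k <= n)%N -> v k <= M * k.+1%:R `^ (- u).
  move=> kn; rewrite powRN ler_pdivlMr ?powR_nat_gt0//.
  apply: (@le_trans _ _ (`|v k| * k.+1%:R `^ u)).
    by rewrite ler_wpM2r ?powR_ge0 ?ler_norm.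
  apply: (@le_trans _ _ (\sum_(0 <= k < n.+1) `|v k| * k.+1%:R `^ u)).
    rewrite (bigD1_seq k) ?iota_uniq ?mem_index_iota//= lerDl.
    by apply: sumr_ge0 => j _; rewrite mulr_ge0 ?powR_ge0.
  by rewrite lerDr divr_ge0 ?mulr_ge0// ltW.
exists M => k; rewrite -/u.
have [|/ltnW nk] := leqP k n; first exact: small.
rewrite -(subnKC nk); move: (k - n)%N => {nk}k.
elim: k => [|k ih]; first by rewrite addn0 small.
rewrite addnS; move: ih (nP _ (leq_addr k n)).
move: (n + k)%N => {}k ih smallk; apply: le_trans (vrec k) _.
have -> : t = s + u by rewrite addrC subrK.
rewrite opprD powRD_nat.
have succ := ler_wpM2l M0 (powR_nat_succ_ge k (ltW u0)).
apply: le_trans succ.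
have ps1 : k.+1%:R `^ (- s) <= 1 :> R by exact/powR_nat_le1/ltW.
have pu0 : 0 < k.+1%:R `^ (- u) :> R by exact: powR_nat_gt0.
have ps0 : 0 < k.+1%:R `^ (- s) :> R by exact: powR_nat_gt0.
have kinv : k.+1%:R^-1 = k.+1%:R `^ (- (1 - s)) * k.+1%:R `^ (- s) :> R.
  by rewrite -powRD_nat opprB addrAC subrr add0r powR_inv1.
move: kinv ps1 pu0 ps0 smallk ih.
move: (k.+1%:R `^ (- s)) (k.+1%:R `^ (- u)) (k.+1%:R `^ _) => a b d.
move=> -> a1 b0 a0 dc vk.
have h1 : (1 - c * a) * v k <= (1 - c * a) * (M * b).
  rewrite ler_wpM2l// subr_ge0.
  by apply: le_trans (ler_pM (ltW c0) (ltW a0) c1 a1) _; rewrite mulr1.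
have h2 : u * d <= c / 2.
  by move: dc; rewrite ler_pdivlMr ?mulr_gt0//; lra.
have h3 : M * (u * d) <= M * (c / 2) by rewrite ler_wpM2l.
have h4 : 0 <= a * b * (M * (c / 2) - M * (u * d)).
  by rewrite mulr_ge0 ?subr_ge0// mulr_ge0// ltW.
have h5 : 0 <= a * b * (M * c - 2 * C).
  by rewrite mulr_ge0 ?subr_ge0// mulr_ge0// ltW.
by lra.
Qed.

Lemma cvg0_powR_bound v M u : 0 < u ->
  (forall k, 0 <= v k <= M * k.+1%:R `^ (- u)) -> v k @[k --> \oo] --> 0.
Proof.
move=> u0 vM; apply/cvgrPdist_le => e e0.
have M0 : 0 < `|M| + 1 by rewrite ltr_wpDl.
have [n nP] := powR_nat_eventually_le u0 (divr_gt0 e0 M0).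
exists n => // k nk; have /andP[v0 vk] := vM k.
rewrite sub0r normrN ger0_norm//; apply: le_trans vk _.
apply: (@le_trans _ _ ((`|M| + 1) * k.+1%:R `^ (- u))).
  by rewrite ler_wpM2r ?powR_ge0// (le_trans (ler_norm M))// lerDl.
by rewrite mulrC -ler_pdivlMr// nP.
Qed.

End real_sequences.

(** * The path of regularized solutions *)

Section distance_to_a_set.
Context {R : realType} {n : nat}.
Implicit Types (S : set 'rV[R]_n) (x y s : 'rV[R]_n).

Lemma edist_set_ge0 x S : 0 <= edist_set x S.
Proof.
rewrite /edist_set; have [->|/set0P S0] := eqVneq S set0.
  by rewrite image_set0 inf0.
by apply: lb_le_inf => [|_ [s _ <-]]; [exact: image_nonempty|exact: enorm_ge0].
Qed.

Lemma edist_set_le x S s : S s -> edist_set x S <= enorm (x - s).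
Proof.
move=> Ss; apply: ge_inf; last by exists s.
by exists 0 => _ [s' _ <-]; exact: enorm_ge0.
Qed.

Lemma edist_set_triangle x y S : S !=set0 ->
  edist_set x S <= enorm (x - y) + edist_set y S.
Proof.
move=> [s0 Ss0]; rewrite -lerBlDl; apply: lb_le_inf.
  by exists (enorm (y - s0)); exists s0.
move=> _ [s Ss <-]; rewrite lerBlDl.
exact: le_trans (edist_set_le x Ss) (enorm_distD _ _ _).
Qed.

End distance_to_a_set.

Section regularization_path.
Context {R : realType} {n : nat}.
Variables (X : set 'rV[R]_n) (F Phi : 'rV[R]_n -> 'rV[R]_n) (L1 L2 mu : R).
Hypotheses (X0 : X !=set0) (closedX : closed X) (convexX : convex_set X).
Hypotheses (L1_ge0 : 0 <= L1) (L2_ge0 : 0 <= L2) (mu_gt0 : 0 < mu).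
Hypotheses (mF : monotone_op F) (LF : elipschitz L1 F).
Hypotheses (mPhi : strongly_monotone_op mu Phi) (LPhi : elipschitz L2 Phi).
Local Notation Freg l := (fun x => F x + l *: Phi x).
Local Notation reg := (ivi_reg X F Phi).
Implicit Types (l : R) (x y s c : 'rV[R]_n).

Lemma regularized_strongly_monotone l : 0 <= l ->
  strongly_monotone_op (l * mu) (Freg l).
Proof.
move=> l0 x y; have := mF x y; have := ler_wpM2l l0 (mPhi x y).
by rewrite !dotvE mulrA; lra.
Qed.

Lemma regularized_lipschitz l : 0 <= l -> elipschitz (L1 + l * L2) (Freg l).
Proof.
move=> l0 x y; rewrite opprD addrACA -scalerBr mulrDl.
apply: le_trans (enormD _ _) _; apply: lerD; first exact: LF.
by rewrite enormZ ger0_norm// -mulrA ler_wpM2l.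
Qed.

Lemma ivi_reg_sol l : 0 < l -> ivi_sol X (Freg l) (reg l).
Proof.
move=> l0; rewrite /ivi_reg; apply: xgetPex.
apply: (ivi_sol_exists X0 closedX convexX (m := l * mu) (L := L1 + l * L2)).
- exact: mulr_gt0.
- by rewrite addr_ge0// mulr_ge0// ltW.
- exact/regularized_strongly_monotone/ltW.
- exact/regularized_lipschitz/ltW.
Qed.

(** Comparing the two problems gives [0 <= dotv (Phi (reg l)) (s - reg l)],
    because [F] is monotone; the strong monotonicity of [Phi] at [s] does the
    rest. *)
Lemma ivi_reg_dist_sol l s : 0 < l -> ivi_sol X F s ->
  enorm (reg l - s) <= enorm (Phi s) / mu.
Proof.
move=> l0 Ss; have := ivi_sol_cross (ivi_reg_sol l0) Ss; set x := reg l => h.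
have := mF x s; have := mPhi x s; have := cauchy_schwarz (Phi s) (s - x).
clearbody x; move: h; rewrite -(opprB x s) enormN !dotvNr.
rewrite (addrAC (F x)) (dotvDl (F x - F s)) dotvZl => h c m f.
have : 0 <= l * - dotv (Phi x) (x - s) by lra.
rewrite pmulr_rge0// ler_pdivlMr// => h'.
have := enorm_ge0 (x - s); rewrite le_eqVlt => /predU1P[<-|e0].
  by rewrite mul0r enorm_ge0.
rewrite mulrC -(ler_pM2r e0) -mulrA -expr2.
by rewrite dotvBl in m; lra.
Qed.

Lemma ivi_reg_Phi_bounded l s : 0 < l -> ivi_sol X F s ->
  enorm (Phi (reg l)) <= (1 + L2 / mu) * enorm (Phi s).
Proof.
move=> l0 Ss.
have h1 := ler_wpM2l L2_ge0 (ivi_reg_dist_sol l0 Ss).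
have h2 := LPhi (reg l) s.
have := enorm_distD (Phi s) (Phi (reg l)) 0; rewrite !subr0.
by rewrite mulrDl mul1r -mulrA (mulrC mu^-1); lra.
Qed.

(** The operators of the two problems differ by [(l - l') *: Phi], and the one
    with the parameter [l'] is strongly monotone of modulus [l' * mu]. *)
Lemma ivi_reg_dist l l' : 0 < l' <= l ->
  enorm (reg l - reg l') <= (l - l') / l' / mu * enorm (Phi (reg l)).
Proof.
move=> /andP[l'0 ll']; have l0 : 0 < l by exact: lt_le_trans ll'.
have := ivi_sol_cross (ivi_reg_sol l0) (ivi_reg_sol l'0).
set x := reg l; set x' := reg l' => h.
have := regularized_strongly_monotone (ltW l'0) x x'.
have := cauchy_schwarz (Phi x) (x' - x).
clearbody x x'; move: h; rewrite -(opprB x x') enormN !dotvNr.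
have -> : F x + l *: Phi x - (F x' + l' *: Phi x') =
    (F x + l' *: Phi x - (F x' + l' *: Phi x')) + (l - l') *: Phi x.
  by apply/rowP => i; rewrite !mxE; ring.
rewrite (dotvDl (_ - _)) dotvZl => h c m.
have ll0 : 0 <= l - l' by rewrite subr_ge0.
have c' := ler_wpM2l ll0 c.
have := enorm_ge0 (x - x'); rewrite le_eqVlt => /predU1P[<-|e0].
  by rewrite mulr_ge0 ?enorm_ge0// !divr_ge0// ltW.
rewrite -(ler_pM2l (mulr_gt0 l'0 mu_gt0)) -(ler_pM2r e0).
rewrite -mulrA -expr2.
have -> : l' * mu * ((l - l') / l' / mu * enorm (Phi x)) =
          (l - l') * enorm (Phi x).
  by field; rewrite !gt_eqF.
by lra.
Qed.

(** As [l] tends to [0] along [reg l --> c], the operator values tend to [F c],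
    since [Phi] is bounded on the path; both conditions defining a solution are
    closed. *)
Lemma ivi_reg_limit c : ivi_sol X F !=set0 ->
  (forall e, 0 < e -> exists l, 0 < l < e /\ enorm (reg l - c) < e) ->
  ivi_sol X F c.
Proof.
move=> [s Ss] cP; pose B := (1 + L2 / mu) * enorm (Phi s).
have B0 : 0 <= B by rewrite mulr_ge0 ?enorm_ge0// addr_ge0// divr_ge0// ltW.
have near_c e : 0 < e -> exists2 l, 0 < l &
    enorm (reg l - c) <= e /\
    enorm (F (reg l) + l *: Phi (reg l) - F c) <= (L1 + B) * e.
  move=> e0; have [l [/andP[l0 le] lc]] := cP _ e0.
  exists l => //; split; first exact: ltW.
  rewrite (addrAC (F _)); apply: le_trans (enormD _ _) _.
  rewrite enormZ (ger0_norm (ltW l0)) (mulrDl L1); apply: lerD.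
    by apply: le_trans (LF _ _) _; rewrite ler_wpM2l// ltW.
  rewrite mulrC; apply: ler_pM; [exact: enorm_ge0|exact: ltW| |exact: ltW].
  exact: ivi_reg_Phi_bounded.
have K0 : 0 < L1 + B + 1 by rewrite ltr_wpDl// addr_ge0.
split=> [|y Xy].
  apply: closedX => A /nbhs_ballP[e /= e0 eA].
  have e'0 : 0 < e / (L1 + B + 1) by exact: divr_gt0.
  have [l l0 [_ lF]] := near_c _ e'0.
  exists (F (reg l) + l *: Phi (reg l)); split.
    by case: (ivi_reg_sol l0).
  apply: eA; rewrite -ball_normE/= distrC.
  apply: le_lt_trans (normr_le_enorm _) _; apply: le_lt_trans lF _.
  by rewrite mulrA ltr_pdivrMr// mulrC ltr_pM2l//; lra.
apply/ler_addgt0Pr => e e0.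
pose K := enorm (y - F c) + (L1 + B) * (enorm c + 1).
have K1 : 0 < K + 1.
  by rewrite ltr_wpDl// addr_ge0 ?enorm_ge0// mulr_ge0// addr_ge0 ?enorm_ge0.
pose d := Num.min 1 (e / (K + 1)).
have d0 : 0 < d by rewrite lt_min ltr01 divr_gt0.
have d1 : d <= 1 by rewrite ge_min lexx.
have Kd : K * d <= e.
  apply: (@le_trans _ _ ((K + 1) * d)); first by rewrite ler_pM2r// lerDl.
  by rewrite mulrC -ler_pdivlMr// ge_min lexx orbT.
have [l l0 [lc lF]] := near_c _ d0.
have [_ /(_ _ Xy)] := ivi_reg_sol l0.
move: (reg l) (F (reg l) + _) lc lF => x g lc lF yg.
have h1 := cauchy_schwarz (F c - g) x; have h2 := cauchy_schwarz (y - F c) (x - c).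
have h3 : enorm x <= enorm c + 1.
  by have := enorm_distD c x 0; rewrite !subr0; lra.
have h4 : enorm (F c - g) * enorm x <= (L1 + B) * d * (enorm c + 1).
  by apply: ler_pM; rewrite ?enorm_ge0// enormB.
have h5 : enorm (y - F c) * enorm (x - c) <= enorm (y - F c) * d.
  by rewrite ler_wpM2l// enorm_ge0.
have -> : dotv (y - F c) c =
    dotv (y - g) x - dotv (F c - g) x - dotv (y - F c) (x - c).
  by rewrite !dotvE; ring.
by rewrite /K in Kd; lra.
Qed.

(** Otherwise parameters tending to [0] would keep the path at distance [e] from
    the solutions; being bounded, these points have a cluster point, which is a
    solution by [ivi_reg_limit]. *)
Lemma ivi_reg_dist_sols_cvg e : ivi_sol X F !=set0 -> 0 < e ->
  exists2 d, 0 < d &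
    forall l, 0 < l < d -> edist_set (reg l) (ivi_sol X F) < e.
Proof.
move=> S0 e0; apply: contrapT => /forall2NP noexp.
have /choice[l lP] : forall k, exists l : R,
    0 < l < k.+1%:R^-1 /\ e <= edist_set (reg l) (ivi_sol X F).
  move=> k; have [[]|/existsNP[l /not_implyP[ld /negP]]] := noexp k.+1%:R^-1.
    by rewrite invr_gt0 ltr0n.
  by rewrite -leNgt => le; exists l.
have [s Ss] := S0; pose r := enorm (Phi s) / mu.
have [|c [_ cP]] := @compact_enorm_ball _ _ s r (reg (l k) @[k --> \oo]) _.
  exists 0%N => // k _; apply: ivi_reg_dist_sol => //.
  by have [/andP[]] := lP k.
have near_c (d : R) : 0 < d -> exists k, l k < d /\ enorm (reg (l k) - c) < d.
  move=> d0; have nc := nbhs_enorm_ball c d0.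
  have nd : \forall k \near \oo, (k.+1%:R^-1 : R) < d.
    exact: near_infty_natSinv_lt (PosNum d0).
  have [|_ [[k kd <-] lc]] :=
      cP [set reg (l k) | k in [set k | k.+1%:R^-1 < d]] _ _ nc.
    by apply: filterS nd => k kd; exists k.
  by exists k; have [/andP[_ lk] _] := lP k; split => //; exact: lt_trans lk kd.
have Sc : ivi_sol X F c.
  apply: ivi_reg_limit => // d d0; have [k [lkd lkc]] := near_c d d0.
  by exists (l k); split => //; have [/andP[->]] := lP k.
have [k [_]] := near_c e e0.
rewrite ltNge => /negP; apply.
by apply: le_trans (edist_set_le _ Sc); have [] := lP k.
Qed.

Hypothesis S0 : ivi_sol X F !=set0.
Local Notation Sol := (ivi_sol X F).

Section tracking.
Variables (u : nat -> 'rV[R]_n) (lambda : nat -> R).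
Hypotheses (lambda_gt0 : forall k, 0 < lambda k).
Hypotheses (lambda_cvg0 : lambda k @[k --> \oo] --> 0).
Hypothesis (u_reg : enorm (u k - reg (lambda k)) @[k --> \oo] --> 0).

Lemma tracking_near e : 0 < e ->
  \forall k \near \oo, enorm (u k - reg (lambda k)) < e /\ lambda k < e.
Proof.
move=> e0; near=> k; split; near: k.
- have /cvgrPdist_lt/(_ _ e0) := u_reg; apply: filterS => k.
  by rewrite sub0r normrN ger0_norm// enorm_ge0.
- have /cvgrPdist_lt/(_ _ e0) := lambda_cvg0; apply: filterS => k.
  by rewrite sub0r normrN gtr0_norm.
Unshelve. all: by end_near. Qed.

Lemma tracking_bounded : exists M : R, forall k, enorm (u k) <= M.
Proof.
have [s Ss] := S0.
have [M [_ MP]] : bounded_fun (fun k => enorm (u k - reg (lambda k))).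
  by apply: cvg_seq_bounded; apply/cvg_ex; exists 0.
exists (M + 1 + (enorm (Phi s) / mu + enorm s)) => k.
have h1 : enorm (u k - reg (lambda k)) <= M + 1.
  have MM : M < M + 1 by rewrite ltrDl.
  by have := MP _ MM k I; rewrite /= ger0_norm// enorm_ge0.
have h2 := ivi_reg_dist_sol (lambda_gt0 k) Ss.
have := enorm_distD (reg (lambda k)) (u k) 0; have := enorm_distD s (reg (lambda k)) 0.
by rewrite !subr0; lra.
Qed.

Lemma tracking_edist_set : edist_set (u k) Sol @[k --> \oo] --> 0.
Proof.
apply/cvgrPdist_lt => e e0; have e2 : 0 < e / 2 by rewrite divr_gt0.
have [d d0 dP] := ivi_reg_dist_sols_cvg S0 e2.
have de0 : 0 < Num.min d (e / 2) by rewrite lt_min d0.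
apply: filterS (tracking_near de0) => k; rewrite !lt_min => -[/andP[_ uk] /andP[lk _]].
rewrite sub0r normrN ger0_norm ?edist_set_ge0//.
apply: le_lt_trans (edist_set_triangle (u k) (reg (lambda k)) S0) _.
by rewrite [e]splitr ltrD// dP// lambda_gt0.
Qed.

Lemma tracking_cluster : cluster (u k @[k --> \oo]) `<=` Sol.
Proof.
move=> c cu; apply: (ivi_reg_limit S0).
move=> e e0; have e2 : 0 < e / 2 by rewrite divr_gt0.
have [|_ [[k [kd lk] <-] uc]] := cu [set u k | k in
    [set k | enorm (u k - reg (lambda k)) < e / 2 /\ lambda k < e / 2]] _ _
    (nbhs_enorm_ball c e2).
  by apply: filterS (tracking_near e2) => k kd; exists k.
exists (lambda k); rewrite lambda_gt0; split.
  by apply: lt_trans lk _; rewrite ltr_pdivrMr// ltr_pMr// ltr1n.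
apply: le_lt_trans (enorm_distD (u k) _ _) _; rewrite [e]splitr ltrD//.
by rewrite enormB.
Qed.

End tracking.

End regularization_path.

(** * Borel vectors, conditional means and almost sure convergence *)

Section borel_vectors.
Context {R : realType}.

Lemma measurable_borelV_coord n (i : 'I_n) :
  measurable_fun setT (fun u : borelV R n => u 0 i : R).
Proof.
apply: (measurability _ (RGenOpens.measurableE R)).
move=> _ [_ [a [b ->] <-]]; rewrite setTI.
apply: sub_sigma_algebra.
apply: (@open_comp _ _ (fun u : 'rV[R]_n => u 0 i)).
  by move=> u _; exact: coord_continuous.
exact: interval_open.
Qed.

Lemma borelV_measurableE n : @measurable _ (borelV R n) = <<s @open 'rV[R]_n >>.
Proof. by []. Qed.

Lemma measurable_borelV_continuous n m (g : 'rV[R]_n -> 'rV[R]_m) :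
  continuous g -> measurable_fun setT (g : borelV R n -> borelV R m).
Proof.
move=> cg; apply: (measurability _ (borelV_measurableE m)).
move=> _ [B oB <-]; rewrite setTI; apply: sub_sigma_algebra.
by apply: open_comp oB => u _; exact: cg.
Qed.

(** An open set is the countable union of the balls for the sup norm that it
    contains and that have a rational center and radius [1 / (k + 1)]; the
    preimage of such a ball is a finite intersection of conditions on the
    coordinates. *)
Lemma measurable_borelV d (T : measurableType d) n (f : T -> borelV R n) :
  (forall i, measurable_fun setT (fun w => (f w : 'rV[R]_n) 0 i)) ->
  measurable_fun setT f.
Proof.
move=> mf; apply: (measurability _ (borelV_measurableE n)).
move=> _ [B oB <-]; rewrite setTI.
pose q (a : 'rV[rat]_n * nat) : 'rV[R]_n := map_mx ratr a.1.
pose rad (a : 'rV[rat]_n * nat) : R := a.2.+1%:R^-1.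
have rad_gt0 a : 0 < rad a by rewrite invr_gt0.
have boxE a (u : 'rV[R]_n) :
    ball (q a) (rad a) u <-> forall i, `|q a 0 i - u 0 i| < rad a.
  split=> [[_ qu] i|qu]; first exact: qu.
  by split=> // j i; rewrite ord1; exact: qu.
have -> : f @^-1` B = \bigcup_a
    (if `[< ball (q a) (rad a) `<=` B >] then f @^-1` ball (q a) (rad a) else set0).
  apply/seteqP; split=> [w Bw|w [a _]]; last by case: asboolP => // aB /aB.
  have [e /= e0 eB] : nbhs_ball (f w : 'rV[R]_n) B.
    by apply/nbhs_ballP; exact: open_nbhs_nbhs.
  have [N _ /(_ N (leqnn N)) /= Ne] : \forall k \near \oo, (k.+1%:R^-1 : R) < e / 2.
    exact: near_infty_natSinv_lt (PosNum (divr_gt0 e0 (ltr0n _ 2))).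
  have /choice[c cP] : forall i, exists c : rat,
      `|ratr c - (f w : 'rV[R]_n) 0 i| < N.+1%:R^-1.
    move=> i; have N0 : 0 < N.+1%:R^-1 :> R by rewrite invr_gt0.
    have [|c] := @rat_in_itvoo R ((f w : 'rV[R]_n) 0 i - N.+1%:R^-1)
      ((f w : 'rV[R]_n) 0 i + N.+1%:R^-1).
      by rewrite ltrBlDr -addrA ltrDl addr_gt0.
    rewrite in_itv/= => /andP[h1 h2]; exists c.
    by rewrite ltr_distl h1 h2.
  pose a : 'rV[rat]_n * nat := (\row_i c i, N).
  have qw i : `|q a 0 i - (f w : 'rV[R]_n) 0 i| < rad a by rewrite !mxE cP.
  exists a => //=; case: asboolP => [_|[]]; first exact/boxE.
  move=> u /boxE au; apply: eB; split=> // j i; rewrite ord1.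
  rewrite /ball/= (le_lt_trans (ler_distD (q a 0 i) _ _))//.
  rewrite [e]splitr; apply: ltrD; first by rewrite distrC (lt_trans (qw i)).
  exact: lt_trans (au i) _.
apply: countable_bigcupT_measurable => [|a]; first exact: countableP.
case: asboolP => // _.
have -> : f @^-1` ball (q a) (rad a) = \big[setI/setT]_(i <- enum 'I_n)
    ((fun w => (f w : 'rV[R]_n) 0 i) @^-1` ball (q a 0 i) (rad a)).
  apply/seteqP; split=> [w /boxE aw|w aw].
    by elim: (enum _) => [|i s ih]; rewrite ?big_nil ?big_cons//; split=> //; exact: aw.
  apply/boxE => i; move: aw; rewrite (big_rem i)/= ?mem_enum//.
  by case.
apply: bigsetI_measurable => i _; rewrite -[X in measurable X]setTI.
by apply: mf => //; exact: measurable_ball.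
Qed.

Lemma measurable_coord d (T : measurableType d) n (f : T -> borelV R n) i :
  measurable_fun setT f -> measurable_fun setT (fun w => (f w : 'rV[R]_n) 0 i).
Proof. exact: measurableT_comp (measurable_borelV_coord i). Qed.

Lemma measurable_borelVD d (T : measurableType d) n (f g : T -> borelV R n) :
  measurable_fun setT f -> measurable_fun setT g ->
  measurable_fun setT (fun w => (f w : 'rV[R]_n) + g w : borelV R n).
Proof.
move=> mf mg; apply: measurable_borelV => i.
under eq_fun do rewrite mxE.
by apply: measurable_funD; exact: measurable_coord.
Qed.

Lemma measurable_borelVZ d (T : measurableType d) n a (f : T -> borelV R n) :
  measurable_fun setT f ->
  measurable_fun setT (fun w => a *: (f w : 'rV[R]_n) : borelV R n).
Proof.
move=> mf; apply: measurable_borelV => i.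
under eq_fun do rewrite mxE.
by apply: measurable_funM => //; exact: measurable_coord.
Qed.

Lemma measurable_borelVB d (T : measurableType d) n (f g : T -> borelV R n) :
  measurable_fun setT f -> measurable_fun setT g ->
  measurable_fun setT (fun w => (f w : 'rV[R]_n) - g w : borelV R n).
Proof.
move=> mf mg; apply: measurable_borelV => i.
have -> : (fun w => ((f w : 'rV[R]_n) - g w) 0 i) =
    (fun w => (f w : 'rV[R]_n) 0 i - (g w : 'rV[R]_n) 0 i).
  by apply/funext => w; rewrite !mxE.
by apply: measurable_funB; exact: measurable_coord.
Qed.

Lemma measurable_borelV_sum d (T : measurableType d) n (a b : nat)
    (f : nat -> T -> borelV R n) :
  (forall j, (a <= j < b)%N -> measurable_fun setT (f j)) ->
  measurable_fun setT (fun w => \sum_(a <= j < b) (f j w : 'rV[R]_n) : borelV R n).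
Proof.
move=> mf; apply: measurable_borelV => i.
have -> : (fun w => (\sum_(a <= j < b) (f j w : 'rV[R]_n)) 0 i) =
    (fun w => \sum_(j <- index_iota a b)
       if j \in index_iota a b then (f j w : 'rV[R]_n) 0 i else 0).
  by apply/funext => w; rewrite summxE big_seq big_mkcond.
apply: measurable_sum => j; rewrite mem_index_iota.
by case: (boolP (a <= j < b)%N) => // abj; exact/measurable_coord/mf.
Qed.

End borel_vectors.

Section probability_lemmas.
Context {d : measure_display} {T : measurableType d} {R : realType}.
Variable P : probability T R.
Local Open Scope ereal_scope.
Import HBNNSimple.

(** Immediate for indicators of sets in the sub-sigma-algebra, hence for simple
    functions; a nonnegative [f] is the increasing limit of simple functions,
    with [f * e] as a dominating function, and any [f] is the difference of its
    positive and negative parts. *)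
Lemma integral_mul_eq0 (U : set (set T)) (f e : T -> R) :
    <<s U >> `<=` measurable ->
    measurable_fun setT (f : g_sigma_algebraType U -> R) ->
    P.-integrable setT (EFin \o e) ->
    P.-integrable setT (fun x => (f x * e x)%:E) ->
    (forall A, <<s U >> A -> \int[P]_(x in A) (e x)%:E = 0) ->
  \int[P]_x (f x * e x)%:E = 0.
Proof.
move=> UT mf ie; pose T' := g_sigma_algebraType U.
have subm (h : T -> R) : measurable_fun (setT : set T') h -> measurable_fun setT h.
  by move=> mh _ B mB; apply: UT; exact: (mh measurableT B mB).
have me : measurable_fun setT e by case/integrableP: ie => /measurable_EFinP.
have dom (h k : T -> R) : measurable_fun (setT : set T') h ->
    (forall x, `|h x| <= `|k x|)%R -> P.-integrable setT (fun x => (k x * e x)%:E) ->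
    P.-integrable setT (fun x => (h x * e x)%:E).
  move=> mh hk; apply: le_integrable => // [|x _].
    by apply/measurable_EFinP; apply: measurable_funM => //; exact: subm.
  by rewrite lee_fin !normrM ler_wpM2r.
move=> ife e0.
have indic0 A : <<s U >> A -> \int[P]_x (\1_A x * e x)%:E = 0.
  move=> UA; rewrite -(e0 A UA) [RHS]integral_mkcond; apply: eq_integral => x _.
  by rewrite patchE indicE; case: ifP => _; rewrite ?mul1r ?mul0r.
have simple0 (g : {nnsfun T' >-> R}) : \int[P]_x (g x * e x)%:E = 0.
  pose h y (x : T) := y%:E * (\1_(g @^-1` [set y]) x * e x)%:E.
  have ih y : P.-integrable setT (fun x => (\1_(g @^-1` [set y]) x * e x)%:E).
    apply: (dom _ (cst 1%R)).
    - apply: measurable_indic; exact: measurable_funPTI.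
    - by move=> x; rewrite indicE normr1; case: (_ \in _); rewrite ?normr1 ?normr0.
    - by apply: eq_integrable ie => // x _; rewrite /= mul1r.
  transitivity (\int[P]_x \sum_(y <- finmap.enum_fset (fset_set (range g))) h y x).
    apply: eq_integral => x _.
    rewrite fimfunE fsbig_finite//= mulr_suml -sumEFin.
    by apply: eq_bigr => y _; rewrite -mulrA EFinM.
  rewrite integral_sum//; last by move=> y; exact: integrableZl.
  apply: big1 => y _; rewrite integralZl// indic0 ?mule0//.
  exact: (measurable_funPTI g (measurable_set1 y)).
have pos (h : T -> R) : (forall x, (0 <= h x)%R) ->
    measurable_fun (setT : set T') h ->
    P.-integrable setT (fun x => (h x * e x)%:E) ->
    \int[P]_x (h x * e x)%:E = 0.
  move=> h0 mh ih.
  have mEh : measurable_fun (setT : set T') (EFin \o h) by exact/measurable_EFinP.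
  pose g := nnsfun_approx measurableT mEh.
  have g_cvg x : (g k x)%:E @[k --> \oo] --> (h x)%:E.
    by apply: cvg_nnsfun_approx => // y _; rewrite lee_fin.
  have g_le k x : (g k x <= h x)%R.
    by rewrite -lee_fin nnsfun_approxE le_approx// => y _; rewrite lee_fin.
  have ig k : P.-integrable setT (fun x => (g k x * e x)%:E).
    apply: (dom _ h) => // x; rewrite !ger0_norm ?h0//.
  have [|||||_ _] := @dominated_convergence _ _ _ P setT measurableT
    (fun k x => (g k x * e x)%:E) (fun x => (h x * e x)%:E)
    (fun x => `|(h x * e x)%:E|).
  - by move=> k; case/integrableP: (ig k).
  - by case/integrableP: ih.
  - apply: aeW => x _.
    under eq_fun do rewrite EFinM; rewrite EFinM.
    by apply: cvgeZr; [|exact: g_cvg].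
  - exact: integrable_abse.
  - apply: aeW => x k _; rewrite lee_fin !normrM ler_wpM2r//.
    by rewrite !ger0_norm ?h0.
  rewrite (_ : [sequence _]_n = cst 0); last by apply/funext => k; exact: simple0.
  by move/cvg_lim => <- //; exact: lim_cst.
have -> : (fun x => (f x * e x)%:E) =
    (fun x => (f^\+%R x * e x)%:E) \- (fun x => (f^\-%R x * e x)%:E).
  apply/funext => x /=; rewrite -EFinB -mulrBl.
  by rewrite -[in LHS](funrposBneg f).
have ipos : P.-integrable setT (fun x => (f^\+%R x * e x)%:E).
  apply: (dom _ f) => //; first exact: measurable_funrpos.
  by move=> x; rewrite ger0_norm ?funrpos_ge0// /funrpos ge_max ler_norm normr_ge0.
have ineg : P.-integrable setT (fun x => (f^\-%R x * e x)%:E).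
  apply: (dom _ f) => //; first exact: measurable_funrneg.
  move=> x; rewrite ger0_norm ?funrneg_ge0// /funrneg ge_max normr_ge0 andbT.
  by rewrite -normrN ler_norm.
rewrite integralB// !pos ?sube0//; first exact: measurable_funrneg.
exact: measurable_funrpos.
Qed.

Local Close Scope ereal_scope.

(** The series of the [V k] has a finite expectation, by monotone convergence,
    hence converges almost surely. *)
Lemma ae_cvg0_summable (V : nat -> T -> R) (M : R) :
    (forall k x, 0 <= V k x) ->
    (forall k, P.-integrable setT (EFin \o V k)) ->
    (forall n, \sum_(0 <= k < n) \int[P]_x V k x <= M) ->
  {ae P, forall x, V k x @[k --> \oo] --> (0 : R)}.
Proof.
move=> V0 iV VM.
pose g x := (\sum_(0 <= k <oo) (V k x)%:E)%E.
have mV k : measurable_fun setT (fun x => (V k x)%:E).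
  by case/integrableP: (iV k).
have g0 x : (0 <= g x)%E by apply: nneseries_ge0 => k _ _; rewrite lee_fin.
have gM : (\int[P]_x g x <= M%:E)%E.
  rewrite integral_nneseries//; last by move=> k x _; rewrite lee_fin.
  apply: lime_le.
    by apply: is_cvg_nneseries => k _ _; apply: integral_ge0 => x _; rewrite lee_fin.
  apply: nearW => m.
  apply: le_trans (_ : (\sum_(0 <= k < m) \int[P]_x V k x)%:E <= _)%E.
    rewrite -sumEFin; apply: lee_sum => k _.
    by rewrite /Rintegral fineK//; exact: integrable_fin_num (iV k).
  by rewrite lee_fin.
have ig : P.-integrable setT g.
  apply/integrableP; split.
    by apply: ge0_emeasurable_sum => // k x _ _; rewrite lee_fin.
  under eq_integral do rewrite gee0_abs//.
  by apply: le_lt_trans gM _; rewrite ltry.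
have := integrable_ae measurableT ig; apply: filterS => x /(_ I) gx.
apply: cvg_series_cvg_0; apply: nondecreasing_is_cvgn.
  by apply: nondecreasing_series => k _ _; exact: V0.
exists (fine (g x)) => _ [k _ <-]; rewrite -lee_fin fineK//= /series/= -sumEFin.
by apply: nneseries_lim_ge => j _ _; rewrite lee_fin.
Qed.

Section linear_combination.
Variables (a b c : R) (f g h : T -> R).
Hypotheses (intf : P.-integrable setT (EFin \o f)).
Hypotheses (intg : P.-integrable setT (EFin \o g)).
Hypotheses (inth : P.-integrable setT (EFin \o h)).

Let intaf : P.-integrable setT (EFin \o (fun w => a * f w)).
Proof. exact: (integrableZl measurableT a intf). Qed.

Let intbg : P.-integrable setT (EFin \o (fun w => b * g w)).
Proof. exact: (integrableZl measurableT b intg). Qed.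

Let intch : P.-integrable setT (EFin \o (fun w => c * h w)).
Proof. exact: (integrableZl measurableT c inth). Qed.

Let intafbg : P.-integrable setT (EFin \o (fun w => a * f w + b * g w)).
Proof. exact: (integrableD measurableT intaf intbg). Qed.

Lemma integrable_linear_combination :
  P.-integrable setT (fun w => (a * f w + b * g w - c * h w)%:E).
Proof. exact: (integrableB measurableT intafbg intch). Qed.

Lemma Rintegral_linear_combination :
  \int[P]_w (a * f w + b * g w - c * h w) =
  a * \int[P]_w f w + b * \int[P]_w g w - c * \int[P]_w h w.
Proof. by rewrite RintegralB// RintegralD// !RintegralZl. Qed.

End linear_combination.

Lemma cond_expectation0_integral (H : set (set T)) (f Y : T -> R) A :
    H `<=` measurable -> is_cond_expectation P H f Y ->
    {ae P, forall w, Y w = 0} -> H A ->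
  (\int[P]_(w in A) (f w)%:E = 0)%E.
Proof.
move=> HT [_ iY _ fY] Y0 HA; have mA := HT _ HA; rewrite fY//.
rewrite (ae_eq_integral (cst 0%E))//; first by rewrite integral0.
  by apply: measurable_funTS; case/integrableP: iY.
by move: Y0; apply: filterS => w -> .
Qed.

Lemma cond_expectation_Rintegral_le (H : set (set T)) (f Y : T -> R) (c : R) :
    H setT -> is_cond_expectation P H f Y -> {ae P, forall w, Y w <= c} ->
  \int[P]_w f w <= c.
Proof.
move=> HT [_ iY _ fY] Yc; rewrite /Rintegral fY//.
have mY : measurable_fun setT Y by case/integrableP: iY => /measurable_EFinP.
have ic : P.-integrable setT (EFin \o cst c) by exact: finite_measure_integrable_cst.
have mYc : measurable_fun setT (fun w => Num.min (Y w) c) by exact: measurable_minr.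
have iYc : P.-integrable setT (fun w => (Num.min (Y w) c)%:E).
  apply: (le_integrable measurableT (g := (fun w => (`|Y w| + `|c|)%:E))).
  - exact/measurable_EFinP.
  - move=> w _; rewrite lee_fin [leRHS]ger0_norm ?addr_ge0//.
    by rewrite /Num.min; case: ifP => _; rewrite ?lerDl ?lerDr.
  - under eq_fun do rewrite EFinD.
    by apply: integrableD => //; [exact: integrable_abse iY|exact: integrable_abse ic].
(* [Y] may exceed [c] on a null set *)
rewrite (ae_eq_integral (fun w => (Num.min (Y w) c)%:E))//; first last.
- by move: Yc; apply: filterS => w /min_idPl ->.
- exact/measurable_EFinP.
- exact/measurable_EFinP.
apply: le_trans (_ : _ <= \int[P]_w c) _; last first.
  suff -> : \int[P]_w c = c by [].
  rewrite Rintegral_cst// -[RHS]mulr1; congr (_ * _).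
  exact: (congr1 fine (probability_setT P)).
apply: le_Rintegral => // w _.
by rewrite ge_min lexx orbT.
Qed.

End probability_lemmas.

(** * The iterates and their noiseless reference run *)

Section iteration.
Context {R : realType} {n : nat}.
Variables (X : set 'rV[R]_n) (F Phi : 'rV[R]_n -> 'rV[R]_n) (L1 L2 mu : R).
Hypotheses (X0 : X !=set0) (closedX : closed X) (convexX : convex_set X).
Hypotheses (L1_ge0 : 0 <= L1) (L2_ge0 : 0 <= L2) (mu_gt0 : 0 < mu).
Hypotheses (mF : monotone_op F) (LF : elipschitz L1 F).
Hypotheses (mPhi : strongly_monotone_op mu Phi) (LPhi : elipschitz L2 Phi).
Variables (eta theta lambda : nat -> R).
Hypotheses (eta_gt0 : forall k, 0 < eta k) (theta_gt0 : forall k, 0 < theta k).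
Hypothesis lambda_gt0 : forall k, 0 < lambda k.
Hypothesis lambda_le1 : forall k, lambda k <= 1.
Hypothesis eta_theta : forall k, 2 * (eta k * theta k) <= 1.
Hypothesis eta_lambda : forall k, (L1 + L2) ^+ 2 <= eta k * (lambda k * mu).
Hypothesis theta_lambda : forall k, theta k * (lambda k * mu) <= 1.
Local Notation Freg k := (fun x => F x + lambda k *: Phi x).
Local Notation reg k := (ivi_reg X F Phi (lambda k)).

Lemma regularized_step_lipschitz k : elipschitz (L1 + L2) (Freg k).
Proof.
move=> x y; have := regularized_lipschitz LF LPhi (ltW (lambda_gt0 k)) x y.
move/le_trans; apply; rewrite ler_wpM2r ?enorm_ge0// lerD2l.
by rewrite ler_piMl.
Qed.

Lemma theta_lambda_ge0 k : 0 <= theta k * (lambda k * mu).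
Proof. by rewrite ltW// !mulr_gt0. Qed.

(** The iterates obtained from the expectation [F] itself, in place of the batch
    means: the reference run to which the random one is compared.  It starts from
    the same point, so that the deviation vanishes at first and is square
    integrable for every law of the starting point. *)
Fixpoint mean_path (y0 : 'rV[R]_n) (k : nat) : 'rV[R]_n :=
  if k is k'.+1 then
    let y := mean_path y0 k' in ipg_step X (theta k') (eta k') (Freg k' y) y
  else y0.

(** [reg k] is a fixed point of the [k]-th step. *)
Lemma mean_path_step_reg y0 k :
  enorm (mean_path y0 k.+1 - reg k) <=
  (1 - theta k * (lambda k * mu) / 2) * enorm (mean_path y0 k - reg k).
Proof.
have regP := ivi_reg_sol X0 closedX convexX L1_ge0 L2_ge0 mu_gt0 mF LF mPhi LPhi
  (lambda_gt0 k).
have /= fixreg := (ivi_sol_fixpoint X0 closedX convexX (Freg k) (reg k)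
  (eta_gt0 k) (theta_gt0 k)).1 regP.
rewrite -{1}fixreg.
apply: (ipg_step_econtraction X0 closedX convexX (L := L1 + L2)) => //.
- exact: addr_ge0.
- by rewrite theta_lambda_ge0/=.
- exact: regularized_step_lipschitz.
- exact: regularized_strongly_monotone (ltW (lambda_gt0 k)) _ _.
Qed.

(** The target [reg k] moves by [O(1 / (k + 1))] while the steps contract by
    [1 - c / (2 (k + 1) ^ s)], so the distance is [O((k + 1) ^ (s - 1))]. *)
Lemma mean_path_tracks c s y0 : ivi_sol X F !=set0 -> 0 < s < 1 -> 0 < c <= 1 ->
    (forall k, theta k * (lambda k * mu) = c * k.+1%:R `^ (- s)) ->
    (forall k, lambda k.+1 <= lambda k <= lambda k.+1 * (1 + k.+1%:R^-1)) ->
  enorm (mean_path y0 k - reg k) @[k --> \oo] --> 0.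
Proof.
move=> [z Sz] s01 /andP[c0 c1] tl lam.
pose B := (1 + L2 / mu) * enorm (Phi z).
have B0 : 0 <= B by rewrite mulr_ge0 ?enorm_ge0// addr_ge0// divr_ge0// ltW.
have s1 : s < 1 by case/andP: s01.
have [|||M MP] := @chung_rate _ (c / 2) (B / mu) s 1
  (fun k => enorm (mean_path y0 k - reg k)) _ _ s01 s1.
- by apply/andP; split; lra.
- by rewrite divr_ge0// ltW.
- move=> k; have /andP[lam1 lam2] := lam k.
  apply: le_trans (enorm_distD (reg k) _ _) _.
  apply: lerD; first by have := mean_path_step_reg y0 k; rewrite tl mulrAC.
  have lam01 : 0 < lambda k.+1 <= lambda k by rewrite lambda_gt0.
  apply: le_trans (ivi_reg_dist X0 closedX convexX L1_ge0 L2_ge0 mu_gt0 mF LF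
    mPhi LPhi lam01) _.
  have PhiB := ivi_reg_Phi_bounded X0 closedX convexX L1_ge0 L2_ge0 mu_gt0 mF LF
    mPhi LPhi (lambda_gt0 k) Sz.
  have h : (lambda k - lambda k.+1) / lambda k.+1 <= k.+1%:R^-1.
    by rewrite ler_pdivrMr// lerBlDl mulrC -[X in X + _]mulr1 -mulrDr.
  have h0 : 0 <= (lambda k - lambda k.+1) / lambda k.+1.
    by rewrite divr_ge0 ?subr_ge0// ltW.
  rewrite powR_inv1// mulrC mulrA [B / mu * _]mulrAC.
  rewrite ler_pM2r ?invr_gt0//; apply: ler_pM => //; exact: enorm_ge0.
by apply: (cvg0_powR_bound (u := 1 - s) (M := M)) => [|k];
  rewrite ?subr_gt0 ?enorm_ge0/=.
Qed.

Section noise.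
Context {d : nat}.
Variables (G : 'rV[R]_n -> 'rV[R]_d -> 'rV[R]_n) (N : nat -> nat).
Hypothesis N_gt0 : forall k, (0 < N k)%N.
Local Notation path := (rvc_ipg X G Phi eta theta lambda N).

Definition noise (s : nat -> nat -> 'rV[R]_d) k (a : 'rV[R]_n) :=
  (N k)%:R^-1 *: \sum_(1 <= j < (N k).+1) (G a (s j k) - F a).

Lemma rvc_ipgS y0 s k : path y0 s k.+1 =
  ipg_step X (theta k) (eta k)
    (Freg k (path y0 s k) + noise s k (path y0 s k)) (path y0 s k).
Proof.
rewrite /= /ipg_step; move: (path y0 s k) => a.
suff -> : (N k)%:R^-1 *: (\sum_(1 <= j < (N k).+1) G a (s j k)) + lambda k *: Phi a =
    F a + lambda k *: Phi a + noise s k a by [].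
rewrite [RHS]addrAC; congr (_ + _); rewrite /noise sumrB scalerBr.
rewrite big_const_nat subn1/= iter_addr addr0 -[F a *+ _]scaler_nat scalerA.
by rewrite mulVf ?scale1r 1?addrC ?subrK// pnatr_eq0 -lt0n.
Qed.

Lemma deviation_step y0 s k x y e :
    x = path y0 s k -> y = mean_path y0 k -> e = noise s k x ->
  enorm (path y0 s k.+1 - mean_path y0 k.+1) ^+ 2 <=
  (1 - theta k * (lambda k * mu)) * enorm (x - y) ^+ 2
  + 2 * (theta k / eta k) * enorm e ^+ 2 - 2 * theta k * dotv (x - y) e.
Proof.
move=> -> -> ->; rewrite rvc_ipgS.
apply: (ipg_step_contraction X0 closedX convexX (L := L1 + L2)) => //.
- exact: addr_ge0.
- exact: regularized_step_lipschitz.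
- exact: regularized_strongly_monotone (ltW (lambda_gt0 k)) _ _.
Qed.

Section stochastic_path.
Context {disp : measure_display} {T : measurableType disp}.
Variable P : probability T R.
Variables (x0 : {RV P >-> borelV R n}) (xis : nat -> nat -> {RV P >-> borelV R d}).
Hypothesis mG : measurable_fun setT
    (fun z : borelV R n * borelV R d => G z.1 z.2 : borelV R n).
Local Notation hist := (history N x0 xis).
Local Notation x k w := (path (x0 w) (fun j s => xis j s w) k).
Local Notation y k w := (mean_path (x0 w) k).
(* the sample space, with the events of the history as measurable sets *)
Local Notation histT k := (g_sigma_algebraType (g_sigma_algebra_preimage x0 `|`
  \bigcup_(s in [set s | (s < k)%N])
    \bigcup_(j in [set j | (1 <= j <= N s)%N])
      g_sigma_algebra_preimage (xis j s))).

Lemma history_le k : hist k `<=` hist k.+1.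
Proof.
apply: sub_sigma_algebra2 => A [|[s /= sk]]; first by left.
by move=> [j jN xA]; right; exists s => /=; [exact: ltnW|exists j].
Qed.

Lemma history_measurable k : hist k `<=` measurable.
Proof.
apply: smallest_sub; first exact: sigma_algebra_measurable.
by move=> A [[B mB <-]|[s _ [j _ [B mB <-]]]]; rewrite setTI; exact: measurable_funPTI.
Qed.

Lemma history_measurable_fun d' (T' : measurableType d') (f : T -> T') k :
  measurable_fun setT (f : histT k -> T') ->
  measurable_fun setT (f : histT k.+1 -> T').
Proof. by move=> mf _ B mB; apply: history_le; exact: (mf measurableT B mB). Qed.

Lemma history_start k : measurable_fun setT (x0 : histT k -> borelV R n).
Proof. by move=> _ B mB; apply: sub_sigma_algebra; left; exists B. Qed.

Lemma history_sample k j : (1 <= j <= N k)%N ->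
  measurable_fun setT (xis j k : histT k.+1 -> borelV R d).
Proof.
move=> jN _ B mB; apply: sub_sigma_algebra; right.
by exists k => //=; exists j => //; exists B.
Qed.

Lemma measurable_ipg_step d' (T' : measurableType d') k (a u : T' -> borelV R n) :
  measurable_fun setT a -> measurable_fun setT u ->
  measurable_fun setT
    (fun w => ipg_step X (theta k) (eta k) (a w) (u w) : borelV R n).
Proof.
move=> ma mu'; apply: measurable_borelVB => //.
apply: measurable_borelVZ; apply: measurable_borelVB => //.
apply: (measurableT_comp
  (measurable_borelV_continuous (eproj_continuous X0 closedX convexX))).
by apply: measurable_borelVB => //; exact: measurable_borelVZ.
Qed.

Lemma measurable_Freg d' (T' : measurableType d') k (u : T' -> borelV R n) :
  measurable_fun setT u -> measurable_fun setT (fun w => Freg k (u w) : borelV R n).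
Proof.
move=> mu'; apply: measurable_borelVD.
  exact: measurableT_comp (measurable_borelV_continuous (elipschitz_continuous LF)) mu'.
apply: measurable_borelVZ.
exact: measurableT_comp (measurable_borelV_continuous (elipschitz_continuous LPhi)) mu'.
Qed.

Lemma measurable_mean_path k :
  measurable_fun setT (fun w : histT k => y k w : borelV R n).
Proof.
elim: k => [|k ih]; first exact: history_start.
apply: history_measurable_fun; apply: measurable_ipg_step => //.
exact: measurable_Freg.
Qed.

Lemma measurable_path k :
  measurable_fun setT (fun w : histT k => x k w : borelV R n).
Proof.
elim: k => [|k ih]; first exact: history_start.
pose a (w : histT k.+1) := Freg k (x k w) + noise (fun j s => xis j s w) k (x k w).
apply: (eq_measurable_fun
    (fun w => ipg_step X (theta k) (eta k) (a w) (x k w) : borelV R n)).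
  by move=> w _; rewrite rvc_ipgS.
have mx := history_measurable_fun ih.
apply: measurable_ipg_step => //; apply: measurable_borelVD.
  exact: measurable_Freg.
apply: measurable_borelVZ; apply: measurable_borelV_sum => j jN.
apply: measurable_borelVB.
  exact: (measurableT_comp mG (measurable_fun_pair mx (history_sample jN))).
exact: measurableT_comp (measurable_borelV_continuous (elipschitz_continuous LF)) mx.
Qed.

Variable nu : R.
Local Notation e k w := (noise (fun j s => xis j s w) k (x k w)).
Hypothesis noise_mean0 : forall k i, exists2 Y,
  is_cond_expectation P (hist k) (fun w => e k w 0 i) Y & {ae P, forall w, Y w = 0}.
Hypothesis noise_var : forall k, exists2 Y,
  is_cond_expectation P (hist k) (fun w => enorm (e k w) ^+ 2) Y &
  {ae P, forall w, Y w <= nu ^+ 2 / (N k)%:R}.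
Local Notation dev k w := (x k w - y k w).

Lemma measurable_dev k i : measurable_fun setT (fun w : histT k => dev k w 0 i).
Proof.
apply: (measurable_coord (f := fun w : histT k => dev k w : borelV R n)).
by apply: measurable_borelVB; [exact: measurable_path|exact: measurable_mean_path].
Qed.

Lemma measurable_devT k i : measurable_fun setT (fun w : T => dev k w 0 i).
Proof.
move=> _ B mB; apply: (@history_measurable k).
exact: (@measurable_dev k i measurableT B mB).
Qed.

Lemma measurable_sqr_dev k :
  measurable_fun setT (fun w : T => enorm (dev k w) ^+ 2).
Proof.
have -> : (fun w : T => enorm (dev k w) ^+ 2) =
    (fun w => \sum_i dev k w 0 i * dev k w 0 i).
  by apply/funext => w; rewrite sqr_enorm.
by apply: measurable_sum => i; apply: measurable_funM; exact: measurable_devT.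
Qed.

Lemma noise_integrable k i : P.-integrable setT (fun w => (e k w 0 i)%:E).
Proof. by have [Y []] := noise_mean0 k i. Qed.

Lemma sqr_noise_integrable k : P.-integrable setT (fun w => (enorm (e k w) ^+ 2)%:E).
Proof. by have [Y []] := noise_var k. Qed.

(** The product is dominated by the sum of the squared norms. *)
Lemma dev_noise_integrable k i :
    P.-integrable setT (fun w => (enorm (dev k w) ^+ 2)%:E) ->
  P.-integrable setT (fun w => (dev k w 0 i * e k w 0 i)%:E).
Proof.
move=> iV.
apply: (le_integrable measurableT
  (g := fun w => (enorm (dev k w) ^+ 2 + enorm (e k w) ^+ 2)%:E)).
- apply/measurable_EFinP; apply: measurable_funM; first exact: measurable_devT.
  by apply/measurable_EFinP; case/integrableP: (noise_integrable k i).
- move=> w _; rewrite lee_fin [leRHS]ger0_norm ?addr_ge0 ?sqr_ge0//.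
  rewrite normrM; apply: le_trans (ler_pM (normr_ge0 _) (normr_ge0 _)
    (coord_le_enorm _ _) (coord_le_enorm _ _)) _.
  move: (enorm (dev k w)) (enorm (e k w)) => a b.
  by have := sqr_ge0 (a - b); have := sqr_ge0 (a + b); lra.
- under eq_fun do rewrite EFinD.
  by apply: integrableD => //; exact: sqr_noise_integrable.
Qed.

(** The deviation is determined by the history, and the noise has conditional
    mean zero. *)
Lemma dev_noise_uncorrelated k i :
    P.-integrable setT (fun w => (enorm (dev k w) ^+ 2)%:E) ->
  (\int[P]_w (dev k w 0 i * e k w 0 i)%:E = 0)%E.
Proof.
move=> iV; have [Y EY Y0] := noise_mean0 k i.
apply: (integral_mul_eq0 (@history_measurable k) (@measurable_dev k i)).
- exact: noise_integrable.
- exact: dev_noise_integrable.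
- by move=> A HA; apply: cond_expectation0_integral EY Y0 HA; exact: history_measurable.
Qed.

Lemma dotv_dev_noise_integrable k :
    P.-integrable setT (fun w => (enorm (dev k w) ^+ 2)%:E) ->
  P.-integrable setT (fun w => (dotv (dev k w) (e k w))%:E).
Proof.
move=> iV; rewrite /dotv; under eq_fun do rewrite -sumEFin.
by apply: integrable_sum => // i _; exact: dev_noise_integrable.
Qed.

Lemma dotv_dev_noise_mean0 k :
    P.-integrable setT (fun w => (enorm (dev k w) ^+ 2)%:E) ->
  \int[P]_w dotv (dev k w) (e k w) = 0.
Proof.
move=> iV; rewrite /Rintegral /dotv; under eq_integral do rewrite -sumEFin.
rewrite integral_sum//; last by move=> i; exact: dev_noise_integrable.
by rewrite big1// => i _; exact: dev_noise_uncorrelated.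
Qed.

Let bound k w : R :=
  (1 - theta k * (lambda k * mu)) * enorm (dev k w) ^+ 2
  + 2 * (theta k / eta k) * enorm (e k w) ^+ 2
  - 2 * theta k * dotv (dev k w) (e k w).

Let bound_integrable k :
    P.-integrable setT (fun w => (enorm (dev k w) ^+ 2)%:E) ->
  P.-integrable setT (EFin \o bound k).
Proof.
move=> iV; rewrite /bound.
apply: integrable_linear_combination => //; first exact: sqr_noise_integrable.
exact: dotv_dev_noise_integrable.
Qed.

Lemma sqr_dev_integrable k :
  P.-integrable setT (fun w => (enorm (dev k w) ^+ 2)%:E).
Proof.
elim: k => [|k iV].
  under eq_fun do rewrite /= subrr enorm0 expr0n.
  exact: finite_measure_integrable_cst.
apply: le_integrable (bound_integrable iV) => //.
  by apply/measurable_EFinP; exact: measurable_sqr_dev.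
move=> w _; rewrite lee_fin ger0_norm ?sqr_ge0// (le_trans _ (ler_norm _))//.
exact: deviation_step.
Qed.

Lemma mean_sqr_dev_step k :
  \int[P]_w (enorm (dev k.+1 w) ^+ 2) <=
  (1 - theta k * (lambda k * mu)) * \int[P]_w (enorm (dev k w) ^+ 2)
  + 2 * (theta k / eta k) * (nu ^+ 2 / (N k)%:R).
Proof.
have iV := sqr_dev_integrable k; have ie := sqr_noise_integrable k.
have iD := dotv_dev_noise_integrable iV.
apply: (@le_trans _ _ (\int[P]_w bound k w)).
  apply: le_Rintegral => //.
  - exact: sqr_dev_integrable.
  - exact: bound_integrable.
  - by move=> w _; exact: deviation_step.
rewrite /bound Rintegral_linear_combination// dotv_dev_noise_mean0//.
rewrite mulr0 subr0 lerD2l.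
rewrite ler_wpM2l//; first by rewrite mulr_ge0// divr_ge0// ltW.
have [Y EY Yle] := noise_var k.
apply: cond_expectation_Rintegral_le EY Yle.
exact: (@measurableT _ (histT k)).
Qed.

(** The mean square deviation is [O((k + 1) ^ (s - t))] with [t - s > 1], hence
    summable, and the squared deviation tends to [0] almost surely. *)
Lemma ae_dev_cvg0 c s C t : 0 < s < 1 -> 0 < c <= 1 -> 0 <= C -> 1 + s < t ->
    (forall k, theta k * (lambda k * mu) = c * k.+1%:R `^ (- s)) ->
    (forall k, 2 * (theta k / eta k) * (nu ^+ 2 / (N k)%:R) <= C * k.+1%:R `^ (- t)) ->
  {ae P, forall w, enorm (dev k w) @[k --> \oo] --> 0}.
Proof.
move=> s01 c01 C0 st tl tn; have s_lt_t : s < t by lra.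
have [k|M MP] := chung_rate (v := fun k => \int[P]_w (enorm (dev k w) ^+ 2))
    c01 C0 s01 s_lt_t.
  apply: le_trans (mean_sqr_dev_step k) _; rewrite tl lerD2l; exact: tn.
pose u := t - s - 1; have u0 : 0 < u by rewrite /u; lra.
have := ae_cvg0_summable (V := fun k w => enorm (dev k w) ^+ 2)
  (M := `|M| * (1 + u^-1)) _ sqr_dev_integrable _.
have sum_le m :
    \sum_(0 <= k < m) \int[P]_w (enorm (dev k w) ^+ 2) <= `|M| * (1 + u^-1).
  apply: le_trans (ler_wpM2l (normr_ge0 M) (powR_nat_sum_le m u0)).
  rewrite mulr_sumr; apply: ler_sum => k _; apply: le_trans (MP k) _.
  have -> : t - s = 1 + u by rewrite /u; ring.
  by rewrite ler_wpM2r ?powR_ge0// ler_norm.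
move=> /(_ (fun k w => sqr_ge0 _) sum_le); apply: filterS => w sqr_cvg0.
have -> : (fun k => enorm (dev k w)) = (fun k => Num.sqrt (enorm (dev k w) ^+ 2)).
  by apply/funext => k; rewrite sqrtr_sqr ger0_norm// enorm_ge0.
rewrite -[X in _ --> X]sqrtr0.
exact: (cvg_comp _ _ sqr_cvg0 (@sqrt_continuous R 0)).
Qed.

Lemma ae_path_tracks c s C t : ivi_sol X F !=set0 ->
    0 < s < 1 -> 0 < c <= 1 -> 0 <= C -> 1 + s < t ->
    (forall k, theta k * (lambda k * mu) = c * k.+1%:R `^ (- s)) ->
    (forall k, lambda k.+1 <= lambda k <= lambda k.+1 * (1 + k.+1%:R^-1)) ->
    (forall k, 2 * (theta k / eta k) * (nu ^+ 2 / (N k)%:R) <= C * k.+1%:R `^ (- t)) ->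
  {ae P, forall w, enorm (x k w - reg k) @[k --> \oo] --> 0}.
Proof.
move=> S0 s01 c01 C0 st tl lam tn.
have := ae_dev_cvg0 s01 c01 C0 st tl tn; apply: filterS => w dev0.
have sum0 := cvgD dev0 (mean_path_tracks (x0 w) S0 s01 c01 tl lam).
rewrite addr0 in sum0.
have sandwich : \forall k \near \oo,
    (cst 0 : nat -> R) k <= enorm (x k w - reg k) <=
    ((fun k => enorm (dev k w)) \+ (fun k => enorm (y k w - reg k))) k.
  by apply: nearW => k; rewrite /= enorm_ge0 enorm_distD.
by apply: (squeeze_cvgr sandwich (cvg_cst _)); exact: sum0.
Qed.

End stochastic_path.

End noise.

End iteration.

(** * The power schedules and the convergence theorem *)

(** Dimension [n.+1] provides two distinct points. *)
Lemma elipschitz_ge0 (R : realType) n (L : R) (f : 'rV[R]_n.+1 -> 'rV[R]_n.+1) :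
  elipschitz L f -> 0 <= L.
Proof.
move=> Lf; pose u : 'rV[R]_n.+1 := const_mx 1.
have u0 : 0 < enorm u.
  by apply: lt_le_trans (coord_le_enorm u 0); rewrite mxE normr1.
have := le_trans (enorm_ge0 _) (Lf u 0); rewrite subr0.
by rewrite pmulr_lge0.
Qed.

Lemma strongly_monotone_le_lipschitz (R : realType) n (m L : R)
    (f : 'rV[R]_n.+1 -> 'rV[R]_n.+1) :
  strongly_monotone_op m f -> elipschitz L f -> m <= L.
Proof.
move=> mf Lf; pose u : 'rV[R]_n.+1 := const_mx 1.
have u0 : 0 < enorm u.
  by apply: lt_le_trans (coord_le_enorm u 0); rewrite mxE normr1.
have := le_trans (mf u 0) (cauchy_schwarz _ _).
move/le_trans/(_ (ler_wpM2r (enorm_ge0 _) (Lf u 0))).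
by rewrite subr0 expr2 mulrA !ler_pM2r.
Qed.

Section schedule.
Context {R : realType}.
Variables (L mu p q r : R).
Hypotheses (mu_gt0 : 0 < mu) (mu_le : mu <= L).
Hypotheses (p_gt0 : 0 < p) (pq : p <= q) (qr : q <= r) (p_le1 : p <= 1).
Local Notation C1 := (L ^+ 2 / mu).
Local Notation C2 := ((8 * C1)^-1).
Implicit Type k : nat.

Let L_gt0 : 0 < L. Proof. exact: lt_le_trans mu_le. Qed.

Lemma schedule_C1_gt0 : 0 < C1.
Proof. by rewrite divr_gt0// exprn_gt0. Qed.

Lemma schedule_C2_gt0 : 0 < C2.
Proof. by rewrite invr_gt0 mulr_gt0// schedule_C1_gt0. Qed.

Lemma schedule_eta_theta k :
  2 * (C1 * k.+1%:R `^ q * (C2 * k.+1%:R `^ (- r))) <= 1.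
Proof.
have := powR_nat_le1 k (_ : 0 <= r - q); rewrite subr_ge0 opprB => /(_ qr).
rewrite powRD_nat => h; have C10 := schedule_C1_gt0.
have -> : 2 * (C1 * k.+1%:R `^ q * (C2 * k.+1%:R `^ (- r))) =
          (k.+1%:R `^ q * k.+1%:R `^ (- r)) / 4.
  by field; rewrite !gt_eqF.
lra.
Qed.

Lemma schedule_eta_lambda k :
  L ^+ 2 <= C1 * k.+1%:R `^ q * (k.+1%:R `^ (- p) * mu).
Proof.
have := powR_nat_ge1 k (_ : 0 <= q - p); rewrite subr_ge0 => /(_ pq).
rewrite powRD_nat => h.
have -> : C1 * k.+1%:R `^ q * (k.+1%:R `^ (- p) * mu) =
          L ^+ 2 * (k.+1%:R `^ q * k.+1%:R `^ (- p)).
  by field; rewrite !gt_eqF.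
by rewrite ler_peMr// sqr_ge0.
Qed.

Lemma schedule_theta_lambda k :
  C2 * k.+1%:R `^ (- r) * (k.+1%:R `^ (- p) * mu) =
  mu * C2 * k.+1%:R `^ (- (p + r)).
Proof. by rewrite opprD powRD_nat; ring. Qed.

Lemma schedule_muC2 : 0 < mu * C2 <= 1.
Proof.
rewrite mulr_gt0 ?schedule_C2_gt0//=.
have C80 : 0 < 8 * C1 by rewrite mulr_gt0// schedule_C1_gt0.
rewrite ler_pdivrMr// mul1r mulrA ler_pdivlMr// -expr2.
have : mu ^+ 2 <= L ^+ 2 by rewrite ler_sqr ?nnegrE// ltW.
by have := sqr_ge0 L; lra.
Qed.

(** [(k + 2) / (k + 1)] raised to the power [p <= 1] is at most itself. *)
Lemma schedule_lambda_succ k :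
  k.+2%:R `^ (- p) <= (k.+1%:R `^ (- p) : R)
                   <= k.+2%:R `^ (- p) * (1 + k.+1%:R^-1).
Proof.
have k0 : 0 < k.+1%:R :> R by rewrite ltr0n.
have pk : 0 < k.+1%:R `^ p :> R by exact: powR_nat_gt0.
have pk1 : 0 < k.+2%:R `^ p :> R by exact: powR_nat_gt0.
rewrite !powRN lef_pV2 ?posrE//; apply/andP; split.
  by apply: ge0_ler_powR; rewrite ?nnegrE ?ler0n ?ler_nat// ltW.
rewrite mulrC ler_pdivlMr// mulrC ler_pdivrMr//.
have -> : k.+2%:R = k.+1%:R * (1 + k.+1%:R^-1) :> R.
  by rewrite mulrDr mulr1 divff ?gt_eqF// natr1.
rewrite powRM// mulrC ler_wpM2r ?powR_ge0//.
by rewrite ler1_powR// lerDl invr_ge0 ltW.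
Qed.

Lemma schedule_noise k (nu delta : R) (m : nat) :
    k.+1%:R `^ (1 + delta) <= m%:R ->
  2 * (C2 * k.+1%:R `^ (- r) / (C1 * k.+1%:R `^ q)) * (nu ^+ 2 / m%:R) <=
  2 * (C2 / C1) * nu ^+ 2 * k.+1%:R `^ (- (r + q + (1 + delta))).
Proof.
move=> km; have km0 := lt_le_trans (powR_nat_gt0 k (1 + delta)) km.
have C10 := schedule_C1_gt0.
have -> : C2 * k.+1%:R `^ (- r) / (C1 * k.+1%:R `^ q) =
    C2 / C1 * k.+1%:R `^ (- (r + q)).
  by rewrite opprD powRD_nat !powRN; field; rewrite !gt_eqF ?powR_nat_gt0.
rewrite [in leRHS]opprD [in leRHS]powRD_nat (powRN _ (1 + delta)).
set a := C2 / C1; set b := k.+1%:R `^ (- (r + q)).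
have -> : 2 * a * nu ^+ 2 * (b / k.+1%:R `^ (1 + delta)) =
    2 * (a * b) * (nu ^+ 2 / k.+1%:R `^ (1 + delta)).
  by field; rewrite gt_eqF// powR_nat_gt0.
have a0 : 0 <= a by rewrite ltW// divr_gt0 ?schedule_C2_gt0 ?schedule_C1_gt0.
have b0 : 0 <= b by exact: powR_ge0.
have ab0 : 0 <= 2 * (a * b) by apply: mulr_ge0 => //; exact: mulr_ge0.
apply: (ler_wpM2l ab0).
by rewrite ler_wpM2l ?sqr_ge0// lef_pV2 ?posrE// powR_nat_gt0.
Qed.

End schedule.

Theorem theorem1 (R : realType) (n d : nat)
    (disp : measure_display) (T : measurableType disp) (P : probability T R)
    (X : set 'rV[R]_n)
    (xi : {RV P >-> borelV R d})
    (G : 'rV[R]_n -> 'rV[R]_d -> 'rV[R]_n)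
    (Phi : 'rV[R]_n -> 'rV[R]_n)
    (x0 : {RV P >-> borelV R n})
    (xis : nat -> nat -> {RV P >-> borelV R d})
    (L1 L2 mu p q r delta : R) :
  let F := fun x => meanV P (fun w => G x (xi w)) in
  let Sol := ivi_sol X F in
  let C1 := (L1 + L2) ^+ 2 / mu in
  let C2 := (8 * C1)^-1 in
  let lambda := fun k : nat => k.+1%:R `^ (- p) in
  let eta := fun k : nat => C1 * k.+1%:R `^ q in
  let theta := fun k : nat => C2 * k.+1%:R `^ (- r) in
  let N := fun k : nat => `|Num.ceil (k.+1%:R `^ (1 + delta) : R)|%N in
  let x := fun (k : nat) (w : T) =>
    rvc_ipg X G Phi eta theta lambda N (x0 w) (fun j k => xis j k w) k in
  let xreg := ivi_reg X F Phi in
  (* setting *)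
  X !=set0 -> closed X -> convex_set X ->
  measurable_fun setT
    (fun z : borelV R n * borelV R d => G z.1 z.2 : borelV R n) ->
  (forall a : 'rV[R]_n, integrableV P (fun w => G a (xi w))) ->
  (forall k j : nat, (1 <= j <= N k)%N -> forall B : set (borelV R d),
     measurable B -> distribution P (xis j k) B = distribution P xi B) ->
  (* problem assumptions *)
  monotone_op F -> elipschitz L1 F ->
  0 < mu -> strongly_monotone_op mu Phi -> elipschitz L2 Phi ->
  Sol !=set0 ->
  (* stochastic error assumption *)
  stochastic_error_assumption P (history N x0 xis) N
    (batch_error G F N xis x) ->
  (* parameters *)
  0 < p -> p <= q -> q <= r -> r < 1 -> p + r < 1 -> 0 < delta ->
  [/\ {ae P, forall w, enorm (x k w - xreg (lambda k)) @[k --> \oo] --> (0 : R)},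
      {ae P, forall w, exists M : R, forall k, enorm (x k w) <= M},
      {ae P, forall w, edist_set (x k w) Sol @[k --> \oo] --> (0 : R)} &
      {ae P, forall w, cluster (x k w @[k --> \oo]) `<=` Sol}].
Proof.
case: n X G Phi x0 => [|n] X G Phi x0 F Sol C1 C2 lambda eta theta N x xreg X0
  closedX convexX mG _ _ mF LF mu0 mPhi LPhi S0 err p_gt0 pq qr r1 pr delta0.
  (* in dimension 0 there is only one point *)
  have [s Ss] := S0.
  have e0 (u : 'rV[R]_0) : enorm u = 0 by rewrite (thinmx0 u) enorm0.
  have d0 u : edist_set u Sol = 0.
    by apply/eqP; rewrite eq_le edist_set_ge0 andbT -(e0 (u - s)) edist_set_le.
  split; apply: aeW => w.
  - by under eq_fun do rewrite e0; exact: cvg_cst.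
  - by exists 0 => k; rewrite e0.
  - by under eq_fun do rewrite d0; exact: cvg_cst.
  - by move=> c _; rewrite (thinmx0 c) -(thinmx0 s).
have L1_ge0 := elipschitz_ge0 LF.
have mu_le_L2 := strongly_monotone_le_lipschitz mPhi LPhi.
have L2_ge0 : 0 <= L2 by lra.
have mu_le : mu <= L1 + L2 by lra.
have r0 : 0 < r by lra.
have lambda_gt0 k : 0 < lambda k by exact: powR_nat_gt0.
have C10 : 0 < C1 := schedule_C1_gt0 mu0 mu_le.
have C20 : 0 < C2 := schedule_C2_gt0 mu0 mu_le.
have N_ge k : k.+1%:R `^ (1 + delta) <= (N k)%:R :> R.
  rewrite /N natr_absz ger0_norm; first exact: Num.Theory.ceil_ge.
  by rewrite Num.Theory.ceil_ge0; apply: lt_trans (powR_nat_gt0 _ _); lra.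
have N_gt0 k : (0 < N k)%N.
  by have := lt_le_trans (powR_nat_gt0 k (1 + delta)) (N_ge k); rewrite ltr0n.
(* the exponents satisfy [r + q + (1 + delta) - (p + r) > 1] because [p <= q] *)
have track : {ae P, forall w,
    enorm (x k w - xreg (lambda k)) @[k --> \oo] --> (0 : R)}.
  have [nu nu0 errP] := err.
  have s01 : 0 < p + r < 1 by apply/andP; split; lra.
  have st : 1 + (p + r) < r + q + (1 + delta) by lra.
  have eta_gt0 k : 0 < eta k by rewrite mulr_gt0// powR_nat_gt0.
  have theta_gt0 k : 0 < theta k by rewrite mulr_gt0// powR_nat_gt0.
  have lambda_le1 k : lambda k <= 1 by rewrite powR_nat_le1// ltW.
  have eta_theta k : 2 * (eta k * theta k) <= 1 by exact: schedule_eta_theta.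
  have eta_lambda k : (L1 + L2) ^+ 2 <= eta k * (lambda k * mu).
    exact: schedule_eta_lambda.
  have c01 := schedule_muC2 mu0 mu_le.
  have theta_lambda k :
      theta k * (lambda k * mu) = mu * C2 * k.+1%:R `^ (- (p + r)).
    exact: schedule_theta_lambda.
  have theta_lambda_le1 k : theta k * (lambda k * mu) <= 1.
    have pr0 : 0 <= p + r by lra.
    rewrite theta_lambda; case/andP: (c01) => c0 c1.
    apply: le_trans c1; apply: ler_piMr; [exact: ltW|exact: powR_nat_le1].
  have C0 : 0 <= 2 * (C2 / C1) * nu ^+ 2.
    by rewrite mulr_ge0 ?sqr_ge0// mulr_ge0// divr_ge0// ltW.
  have p_le1 : p <= 1 by lra.
  have noise_le k : 2 * (theta k / eta k) * (nu ^+ 2 / (N k)%:R) <=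
      2 * (C2 / C1) * nu ^+ 2 * k.+1%:R `^ (- (r + q + (1 + delta))).
    exact: schedule_noise.
  exact: (ae_path_tracks X0 closedX convexX L1_ge0 L2_ge0 mu0 mF LF mPhi LPhi
    eta_gt0 theta_gt0 lambda_gt0 lambda_le1 eta_theta eta_lambda theta_lambda_le1
    N_gt0 mG (fun k i => (errP k).1 i) (fun k => (errP k).2) S0 s01 c01 C0 st
    theta_lambda (schedule_lambda_succ p_gt0 p_le1) noise_le).
have lambda_cvg0 : lambda k @[k --> \oo] --> 0.
  apply: (cvg0_powR_bound (u := p) (M := 1)) => // k.
  by rewrite mul1r lexx andbT ltW.
split; move: track; apply: filterS => w xw //.
- exact: (tracking_bounded X0 closedX convexX L1_ge0 L2_ge0 mu0 mF LF mPhi LPhi S0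
    lambda_gt0).
- exact: (tracking_edist_set X0 closedX convexX L1_ge0 L2_ge0 mu0 mF LF mPhi LPhi S0
    lambda_gt0).
- exact: (tracking_cluster X0 closedX convexX L1_ge0 L2_ge0 mu0 mF LF mPhi LPhi S0
    lambda_gt0).
Qed.
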